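(* Let $n\ge2$ and let $\lambda=-\lambda_1\epsilon_1-\cdots-\lambda_n\epsilon_n\in\Lambda^-$ be such that $\lambda_i>\lambda_{i+1}$ for all $i\in I_0=\{1,\dots,n-1\}$. Let $$\mu=\sum_{i=1}^n(\lambda_i-k)\,\epsilon_{n+1-i}$$ for some integer $k\ge-\min\{\lambda_i : i\in I_0\}$. Then the connected component $\mathcal C$ of $\mathrm{SDT}(-\infty)\otimes\mathcal R_\mu^\vee$ generated by $L^{-\infty}\otimes r_\mu^\vee$ is isomorphic to $\mathrm{SDT}(\lambda)$ as $\mathfrak q(n)$-crystals (isomorphism being understood up to a shift of the weight by a multiple of $(1,\dots,1)$, i.e. preserving $\mathrm{wt}_i$ for all $i\in I_0$ rather than $\mathrm{wt}$).
   Context: **Notation.** $I_0=\{1,\dots,n-1\}$, $I=I_0\sqcup\{\overline1\}$; $\epsilon_1,\dots,\epsilon_n$ is the standard basis of $\mathbb{Z}^n$; $\alpha_i=\epsilon_i-\epsilon_{i+1}$. $\Lambda^-$ is the set of $\lambda=-\lambda_1\epsilon_1-\cdots-\lambda_n\epsilon_n$ with integers $\lambda_1\ge\cdots\ge\lambda_n\ge 0$ such that $\lambda_i=\lambda_{i+1}$ implies $\lambda_i=\lambda_{i+1}=0$. **Crystals.** The crystals below are sets $\mathcal B$ with maps $e_i,f_i:\mathcal B\to\mathcal B\sqcup\{\mathbf0\}$ ($i\in I$), $\varepsilon_i,\varphi_i:\mathcal B\to\mathbb Z\sqcup\{-\infty\}$ ($i\in I_0$), $\mathrm{wt}:\mathcal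 B\to\mathbb Z^n$; write $\mathrm{wt}_i(b)=\nu_i-\nu_{i+1}$ if $\mathrm{wt}(b)=\sum_j\nu_j\epsilon_j$. A morphism $\psi:\mathcal B\to\mathcal C\sqcup\{\mathbf0\}$ (with $\psi(\mathbf 0)=\mathbf 0$) is required to satisfy, when $\psi(b)\in\mathcal C$, $\mathrm{wt}_i(\psi(b))=\mathrm{wt}_i(b)$, $\varepsilon_i(\psi(b))=\varepsilon_i(b)$, $\varphi_i(\psi(b))=\varphi_i(b)$ for $i\in I_0$, and for $i\in I$: $\psi(e_ib)=e_i\psi(b)$ provided $\psi(e_ib)\ne\mathbf0$ and $e_i\psi(b)\neq\mathbf0$; likewise for $f_i$. It is an isomorphism if the induced map $\mathcal B\sqcup\{\mathbf0\}\to\mathcal C\sqcup\{\mathbf0\}$ is bijective. The connected component generated by $b$ is the set of all elements obtained from $b$ by applying finite sequences of the operators $e_i,f_i$ ($i\in I$). **Tensor products.** $\mathcal B\otimes\mathcal C$ is $\mathcal B\times\mathcal C$ with, for $i\in I_0$: $e_i(b\otimes c)=e_ib\otimes c$ if $\varphi_i(c)<\varepsilon_i(b)$, and $b\otimes e_ic$ otherwise; $f_i(b\otimes c)=f_ib\otimes c$ if $\varphi_i(c)\le\varepsilon_i(b)$, and $b\otimes f_ic$ otherwise; $e_{\overline1}(b\otimes c)=b\otimes e_{\overline1}c$ if $e_{\overline1}b=f_{\overline1}b=\mathbf0$, and $e_{\overline1}b\otimes c$ otherwise; $f_{\overline1}(b\otimes c)=b\otimes f_{\overline1}c$ if $e_{\overline1}b=f_{\overline1}b=\mathbf0$,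 and $f_{\overline1}b\otimes c$ otherwise; $\varepsilon_i(b\otimes c)=\max(\varepsilon_i(c),\varepsilon_i(b)-\mathrm{wt}_i(c))$, $\varphi_i(b\otimes c)=\max(\varphi_i(b),\varphi_i(c)+\mathrm{wt}_i(b))$, $\mathrm{wt}(b\otimes c)=\mathrm{wt}(b)+\mathrm{wt}(c)$. (Tensors with a factor $\mathbf0$ are $\mathbf0$.) For $\mu=(\mu_1,\dots,\mu_n)\in\mathbb Z^n$, $\mathcal R_\mu^\vee=\{r_\mu^\vee\}$ with all $e_i,f_i$ ($i\in I$) zero, $\varepsilon_i(r_\mu^\vee)=0$, $\varphi_i(r_\mu^\vee)=\mu_i-\mu_{i+1}$ ($i\in I_0$), $\mathrm{wt}(r_\mu^\vee)=\mu$. **Tableaux.** A word $u_1\cdots u_N$ is a hook word if $u_1\ge\cdots\ge u_k<u_{k+1}<\cdots<u_N$ for some $1\le k\le N$. For $\lambda\in\Lambda^-$, consider the shifted diagram whose $k$-th row from the top has $\lambda_k$ boxes and is shifted $k-1$ units to the right. $\mathrm{SDT}(\lambda)$ is the set of semistandard decomposition tableaux of this shape: fillings with letters in $\{1,\dots,n\}$ such that, with $v_k$ the $k$-th row (from the top) read left to right, each nonempty $v_k$ is a hook word and $v_k$ is a hook subword (not necessarily contiguous) of maximal length in the concatenation $v_{k+1}v_k$. Rows are always counted from the top. $\mathrm{rd}(T)$ is the word obtained by reading each row from right to left, rows from top to bottom; $\mathrm{rd}_i(T)$ is its subword of letters $i,i+1$; $\overline{\mathrm{rd}}_i(T)$ is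 obtained from $\mathrm{rd}_i(T)$ by successively removing adjacent pairs $(i+1,i)$ (in that order), so it consists of $i$'s followed by $(i+1)$'s. $L^\lambda\in\mathrm{SDT}(\lambda)$ is the tableau whose $k$-th row is filled with $n+1-k$. Crystal structure on $\mathrm{SDT}(\lambda)$: for $i\in I_0$, $e_iT$ changes to $i$ the box of the leftmost $i+1$ of $\overline{\mathrm{rd}}_i(T)$ ($\mathbf0$ if none); $f_iT$ changes to $i+1$ the box of the rightmost $i$ of $\overline{\mathrm{rd}}_i(T)$ ($\mathbf 0$ if none); $e_{\overline1}T$ changes to $1$ the box of the leftmost letter of $\mathrm{rd}_1(T)$ if that letter is $2$ and is $\mathbf 0$ otherwise; $f_{\overline1}T$ changes to $2$ the box of the leftmost letter of $\mathrm{rd}_1(T)$ if that letter is $1$ and is $\mathbf0$ otherwise. $\varepsilon_i(T)$ and $\varphi_i(T)$ are the numbers of $(i+1)$'s and $i$'s in $\overline{\mathrm{rd}}_i(T)$; $\mathrm{wt}(T)=\sum_j(\#j\text{ in }T)\epsilon_j$. **The crystal $\mathrm{SDT}(-\infty)$.** A semistandard decomposition tableau $T$ is dual marginally large if it has $n$ (nonempty) rows and, for each $1\le i\le n$, the number of leftmost $i$-boxes in row $n-i+1$ (the length of the maximal initial run of $i$'s) exceeds the total number of boxes of row $n-i+2$ by exactly one (row $n+1$ is empty). $\mathrm{SDT}(-\infty)$ is the set of these; $L^{-\infty}$ denotes its element with row lengths $n,n-1,\dots,1$ whose $k$-th row is filled with $n+1-k$. For $i\in I$, $e_iT$ and $f_iT$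 are given as follows (put $i'=i$ for $i\in I_0$ and $i'=1$ for $i=\overline1$). Apply the same rule as on $\mathrm{SDT}(\lambda)$; if this gives $\mathbf0$ the result is $\mathbf0$; otherwise let $T'$ be the resulting tableau. If $T'$ is dual marginally large, it is the result. If not, the result is obtained from $T'$, in the case of $e_i$ (resp. $f_i$), by adding (resp. removing) one $(n-k+1)$-box at the left of row $k$ for each $1\le k\le n-i'$ (sliding boxes back to a shifted shape). For $T\in\mathrm{SDT}(-\infty)$ of the same shape as $L^\nu$: $\mathrm{wt}(T)=\sum_j(\#j\text{ in }T-\#j\text{ in }L^\nu)\epsilon_j$, $\varphi_i(T)$ is the number of $i$'s in $\overline{\mathrm{rd}}_i(T)$, and $\varepsilon_i(T)=\varphi_i(T)-\mathrm{wt}_i(T)$. *)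

(* Defs.v *)
From mathcomp Require Import all_boot all_order all_algebra.
From mathcomp Require Import boolp.
From mathcomp Require Import zify.

Set Implicit Arguments.
Unset Strict Implicit.
Unset Printing Implicit Defensive.

Import Order.TTheory GRing.Theory Num.Theory.

(** * The index set [I = I_0 + {1bar}] and weights *)

(* [I_0 = {1, ..., n-1}] is encoded as ['I_n.-1] and [{1, ..., n}] as ['I_n]:
   the ordinal [i] stands for the index [i.+1].  Letters of tableaux, on the
   other hand, are the actual numbers [1, ..., n]. *)
Inductive qindex (n : nat) : Type :=
| Even of 'I_n.-1
| Odd1.
Arguments Odd1 {n}.

Lemma ltn_I0 (n : nat) (i : 'I_n.-1) : (i.+1 < n)%N.
Proof. by case: n i => [|n] [i] /=. Qed.

(* For [i] in [I_0]: the indices [i] and [i + 1] of the coordinates. *)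
Definition cur n (i : 'I_n.-1) : 'I_n := widen_ord (leq_pred n) i.
Definition nxt n (i : 'I_n.-1) : 'I_n := Ordinal (ltn_I0 i).

Definition pairing n (v : 'rV[int]_n) (i : 'I_n.-1) : int :=
  (v ord0 (cur i) - v ord0 (nxt i))%R.

(** * The values of [eps_i] and [phi_i]: integers or minus infinity *)

Inductive zbar : Type := Fin of int | NegInf.

Definition zle (x y : zbar) : bool :=
  match x, y with
  | NegInf, _ => true
  | Fin _, NegInf => false
  | Fin a, Fin b => (a <= b)%R
  end.

Definition zlt (x y : zbar) : bool := ~~ zle y x.

Definition zmax (x y : zbar) : zbar := if zle x y then y else x.

Definition zadd (x : zbar) (a : int) : zbar :=
  if x is Fin b then Fin (b + a)%R else NegInf.

(** * Crystals; [None] plays the role of the extra element [0] *)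

Record crystal (n : nat) : Type := Crystal {
  car :> Type;
  ce : qindex n -> car -> option car;
  cf : qindex n -> car -> option car;
  ceps : 'I_n.-1 -> car -> zbar;
  cphi : 'I_n.-1 -> car -> zbar;
  cwt : car -> 'rV[int]_n
}.

Definition cwti n (B : crystal n) (i : 'I_n.-1) (b : B) : int :=
  pairing (cwt b) i.

(* [obind] extends maps and operators by [0 |-> 0]. *)
Record is_morphism n (B C : crystal n) (psi : B -> option C) : Prop := {
  morphism_wti : forall b c, psi b = Some c ->
    forall i : 'I_n.-1, cwti i c = cwti i b;
  morphism_eps : forall b c, psi b = Some c ->
    forall i : 'I_n.-1, ceps i c = ceps i b;
  morphism_phi : forall b c, psi b = Some c ->
    forall i : 'I_n.-1, cphi i c = cphi i b;
  morphism_e : forall b c, psi b = Some c -> forall i : qindex n,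
    obind psi (ce i b) <> None -> ce i c <> None ->
    obind psi (ce i b) = ce i c;
  morphism_f : forall b c, psi b = Some c -> forall i : qindex n,
    obind psi (cf i b) <> None -> cf i c <> None ->
    obind psi (cf i b) = cf i c
}.

Definition is_isomorphism n (B C : crystal n) (psi : B -> option C) : Prop :=
  is_morphism psi /\ bijective (fun x : option B => obind psi x).

Definition isomorphic n (B C : crystal n) : Prop :=
  exists psi : B -> option C, is_isomorphism psi.

(* The crystal carried by a subset [P] of [B].  It is only used for subsets
   stable under the operators, so that [insub] never yields [None] here. *)
Definition subcrystal n (B : crystal n) (P : pred B) : crystal n :=
  @Crystal n {x : B | P x}
    (fun i x => obind insub (ce i (val x)))
    (fun i x => obind insub (cf i (val x)))
    (fun i x => ceps i (val x))
    (fun i x => cphi i (val x))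
    (fun x => cwt (val x)).

Inductive connected n (B : crystal n) (b : B) : B -> Prop :=
| conn_refl : connected b b
| conn_e i x y : connected b x -> ce i x = Some y -> connected b y
| conn_f i x y : connected b x -> cf i x = Some y -> connected b y.

Definition component n (B : crystal n) (b : B) : crystal n :=
  subcrystal [pred x : B | `[< connected b x >]].

Definition tensor n (B C : crystal n) : crystal n :=
  @Crystal n (B * C)%type
    (fun x bc => let: (b, c) := bc in
      let left_act := omap (fun b' => (b', c)) (ce x b) in
      let right_act := omap (fun c' => (b, c')) (ce x c) in
      match x with
      | Even i => if zlt (cphi i c) (ceps i b) then left_act else right_act
      | Odd1 => if (ce Odd1 b, cf Odd1 b) is (None, None)
                then right_act else left_act
      end)
    (fun x bc => let: (b, c) := bc in
      let left_act := omap (fun b' => (b', c)) (cf x b) in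
      let right_act := omap (fun c' => (b, c')) (cf x c) in
      match x with
      | Even i => if zle (cphi i c) (ceps i b) then left_act else right_act
      | Odd1 => if (ce Odd1 b, cf Odd1 b) is (None, None)
                then right_act else left_act
      end)
    (fun i bc => let: (b, c) := bc in
      zmax (ceps i c) (zadd (ceps i b) (- cwti i c)%R))
    (fun i bc => let: (b, c) := bc in
      zmax (cphi i b) (zadd (cphi i c) (cwti i b)))
    (fun bc => let: (b, c) := bc in (cwt b + cwt c)%R).

(* The one-element crystal [R_mu^vee]; its element [r_mu^vee] is [tt]. *)
Definition Rvee n (mu : 'rV[int]_n) : crystal n :=
  @Crystal n unit
    (fun _ _ => None)
    (fun _ _ => None)
    (fun _ _ => Fin 0%R)
    (fun i _ => Fin (pairing mu i))
    (fun _ => mu).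

(** * Semistandard decomposition tableaux *)

(* The list of rows, from top to bottom, each read from left to right.  The
   tableaux considered below always have [n] rows, the last of which may be
   empty; the row of number [k] has position [k - 1] in the list. *)
Definition tableau : Type := seq (seq nat).

Definition hook_word (u : seq nat) : bool :=
  [exists k : 'I_(size u), sorted geq (take k.+1 u) && sorted ltn (drop k u)].

(* [mask m u], for [m] a bit sequence, runs through the subwords of [u]. *)
Definition row_ok (below v : seq nat) : bool :=
  (v != [::]) ==>
    hook_word v &&
    [forall m : (size (below ++ v)).-tuple bool,
       hook_word (mask m (below ++ v)) ==>
       (size (mask m (below ++ v)) <= size v)].

(* The element [- s_1 eps_1 - ... - s_n eps_n] of [Lambda^-] is represented by
   the sequence [s_1, ..., s_n]. *)
Definition LambdaMinus (n : nat) (s : seq nat) : bool :=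
  (size s == n) &&
  sorted (fun a b => (b <= a) && ((a == b) ==> (a == 0))) s.

Definition is_SDT (n : nat) (T : tableau) : bool :=
  [&& LambdaMinus n (shape T),
      all (all (fun a => 1 <= a <= n)) T &
      all (fun r => row_ok (nth [::] T r.+1) (nth [::] T r)) (iota 0 n)].

(* The tableau of shape [s] whose [k]-th row is filled with [n + 1 - k]. *)
Definition Ltab (n : nat) (s : seq nat) : tableau :=
  mkseq (fun r => nseq (nth 0 s r) (n - r)) n.

Definition rd (T : tableau) : seq nat := flatten [seq rev v | v <- T].

(* [T] with the letter at position [p] of [rd T] replaced by [a]. *)
Definition change (T : tableau) (p a : nat) : tableau :=
  [seq rev v | v <- reshape (shape T) (set_nth 0 (rd T) p a)].

(* The letters [i] and [i + 1] of a word, paired with their positions. *)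
Definition letters (i : nat) (w : seq nat) : seq (nat * nat) :=
  [seq y <- zip w (iota 0 (size w)) | (y.1 == i) || (y.1 == i.+1)].

(* Removal of the adjacent pairs [(i+1, i)], by means of a stack. *)
Definition reduce_step (i : nat) (stack : seq (nat * nat)) (x : nat * nat) :=
  if stack is y :: stack' then
    if (y.1 == i.+1) && (x.1 == i) then stack' else x :: stack
  else [:: x].

Definition reduced (i : nat) (w : seq nat) : seq (nat * nat) :=
  rev (foldl (reduce_step i) [::] (letters i w)).

Definition tab_e n (x : qindex n) (T : tableau) : option tableau :=
  match x with
  | Even i =>
      omap (fun y => change T y.2 i.+1)
        (ohead [seq y <- reduced i.+1 (rd T) | y.1 == i.+2])
  | Odd1 =>
      obind (fun y => if y.1 == 2 then Some (change T y.2 1) else None)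
        (ohead (letters 1 (rd T)))
  end.

Definition tab_f n (x : qindex n) (T : tableau) : option tableau :=
  match x with
  | Even i =>
      omap (fun y => change T y.2 i.+2)
        (ohead (rev [seq y <- reduced i.+1 (rd T) | y.1 == i.+1]))
  | Odd1 =>
      obind (fun y => if y.1 == 1 then Some (change T y.2 2) else None)
        (ohead (letters 1 (rd T)))
  end.

Definition tab_eps n (i : 'I_n.-1) (T : tableau) : nat :=
  count (fun y => y.1 == i.+2) (reduced i.+1 (rd T)).

Definition tab_phi n (i : 'I_n.-1) (T : tableau) : nat :=
  count (fun y => y.1 == i.+1) (reduced i.+1 (rd T)).

Definition tab_wt n (T : tableau) : 'rV[int]_n :=
  (\row_(j < n) (count_mem j.+1 (rd T))%:Z)%R.

Definition tab_crystal (n : nat) : crystal n :=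
  @Crystal n tableau (@tab_e n) (@tab_f n)
    (fun i T => Fin (tab_eps i T)) (fun i T => Fin (tab_phi i T)) (@tab_wt n).

Definition SDT n (lam : n.-tuple nat) : crystal n :=
  @subcrystal n (tab_crystal n)
    [pred T : tableau | is_SDT n T && (shape T == lam)].

(** * The crystal [SDT(-oo)] *)

(* [find (predC1 i) v] is the length of the maximal initial run of [i] in
   [v]. *)
Definition is_SDTinf (n : nat) (T : tableau) : bool :=
  [&& is_SDT n T, [::] \notin T &
      all (fun i => find (predC1 i) (nth [::] T (n - i))
                    == (size (nth [::] T (n - i).+1)).+1) (iota 1 n)].

Definition prime_index n (x : qindex n) : nat :=
  if x is Even i then i.+1 else 1.

Definition add_boxes (n i' : nat) (T : tableau) : tableau :=
  mkseq (fun r => let v := nth [::] T r in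
                  if r < n - i' then (n - r) :: v else v) n.

(* The leftmost box of each of the rows concerned contains [n - k + 1] when
   this is used. *)
Definition remove_boxes (n i' : nat) (T : tableau) : tableau :=
  mkseq (fun r => let v := nth [::] T r in
                  if r < n - i' then behead v else v) n.

Definition inf_e n (x : qindex n) (T : tableau) : option tableau :=
  omap (fun T' => if is_SDTinf n T' then T'
                  else add_boxes n (prime_index x) T')
    (tab_e x T).

Definition inf_f n (x : qindex n) (T : tableau) : option tableau :=
  omap (fun T' => if is_SDTinf n T' then T'
                  else remove_boxes n (prime_index x) T')
    (tab_f x T).

Definition inf_wt n (T : tableau) : 'rV[int]_n :=
  (tab_wt n T - tab_wt n (Ltab n (shape T)))%R.

Definition inf_crystal (n : nat) : crystal n :=
  @Crystal n tableau (@inf_e n) (@inf_f n)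
    (fun i T => Fin ((tab_phi i T)%:Z - pairing (inf_wt n T) i)%R)
    (fun i T => Fin (tab_phi i T)) (@inf_wt n).

Definition SDTinf (n : nat) : crystal n :=
  @subcrystal n (inf_crystal n) (is_SDTinf n).

Definition Linf_tab (n : nat) : tableau := Ltab n (mkseq (subn n) n).

Lemma mask_nseq (m : bitseq) (p a : nat) :
  exists2 q, mask m (nseq p a) = nseq q a & q <= p.
Proof.
elim: m p => [|b m IHm] [|p] /=; try by exists 0.
have [q -> leqp] := IHm p; case: b.
  by exists q.+1.
by exists q => //; apply: leq_trans leqp _.
Qed.

Lemma hook_two_runs (a b x y : nat) :
  a < b -> hook_word (nseq x a ++ nseq y b) -> 0 < x -> y <= 1.
Proof.
move=> ab /existsP [[k klt] /= /andP [/(sortedP 0) dec /(sortedP 0) inc]] x0.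
rewrite leqNgt; apply/negP => y1.
have sz : size (nseq x a ++ nseq y b) = x + y by rewrite size_cat !size_nseq.
rewrite sz in klt.
have ntha j : j < x -> nth 0 (nseq x a ++ nseq y b) j = a.
  by move=> jx; rewrite nth_cat size_nseq jx nth_nseq jx.
have nthb j : x <= j < x + y -> nth 0 (nseq x a ++ nseq y b) j = b.
  move=> /andP [xj jxy]; rewrite nth_cat size_nseq ltnNge xj /= nth_nseq.
  by have -> : j - x < y by lia.
case: (leqP x k) => kx.
  have := dec x.-1; rewrite size_take sz => /(_ _).
  have -> : x.-1.+1 < (if k.+1 < x + y then k.+1 else x + y) by case: ifP; lia.
  move=> /(_ isT).
  rewrite !nth_take; try lia.
  rewrite ntha; last lia.
  rewrite nthb; last lia.
  by rewrite /geq /= leqNgt ab.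
have := inc (x - k); rewrite size_drop sz !nth_drop => /(_ _).
have -> : (x - k).+1 < x + y - k by lia.
move=> /(_ isT).
by rewrite !nthb; try lia; rewrite ltnn.
Qed.

Lemma nth_Linf (n r : nat) : nth [::] (Linf_tab n) r = nseq (n - r) (n - r).
Proof.
case: (ltnP r n) => rn; first by rewrite !nth_mkseq.
rewrite nth_default ?size_mkseq //.
by have -> : n - r = 0 by lia.
Qed.

Lemma Linf_is_SDTinf (n : nat) : is_SDTinf n (Linf_tab n).
Proof.
have shL : shape (Linf_tab n) = mkseq (subn n) n.
  apply: (@eq_from_nth _ 0); rewrite ?size_map ?size_iota // => i ilt.
  rewrite /shape (nth_map [::]) ?size_mkseq //.
  by rewrite nth_Linf size_nseq nth_mkseq.
apply/and3P; split; first apply/and3P; first split.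
- rewrite /LambdaMinus shL size_mkseq eqxx /=.
  apply/(sortedP 0) => i; rewrite size_mkseq => ilt.
  by rewrite !nth_mkseq; lia.
- apply/allP => v /mapP [r]; rewrite mem_iota => rn ->.
  by apply/allP => a /nseqP [-> _]; lia.
- apply/allP => r; rewrite mem_iota add0n => /andP [_ rn].
  rewrite !nth_Linf /row_ok; apply/implyP => _.
  apply/andP; split.
    apply/existsP.
    have klt : (n - r).-1 < size (nseq (n - r) (n - r)).
      by rewrite size_nseq; lia.
    exists (Ordinal klt) => /=; apply/andP; split.
      apply/(sortedP 0) => i; rewrite size_take size_nseq => ilt.
      have ilt' : i.+1 < n - r by move: ilt; case: ifP; lia.
      rewrite !nth_take; try lia.
      by rewrite !nth_nseq ilt' (ltnW ilt') /=.
    apply/(sortedP 0) => i; rewrite size_drop size_nseq; lia.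
  apply/forallP => m; apply/implyP.
  set u := nseq _ _ ++ nseq _ _.
  pose m1 := take (n - r.+1) m; pose m2 := drop (n - r.+1) m.
  have szu : size u = (n - r.+1) + (n - r) by rewrite size_cat !size_nseq.
  have -> : mask m u = mask m1 (nseq (n - r.+1) (n - r.+1))
                       ++ mask m2 (nseq (n - r) (n - r)).
    rewrite -mask_cat ?cat_take_drop //.
    rewrite size_takel ?size_nseq // size_tuple szu.
    exact: leq_addr.
  have [x -> xle] := mask_nseq m1 (n - r.+1) (n - r.+1).
  have [y -> yle] := mask_nseq m2 (n - r) (n - r).
  rewrite size_cat !size_nseq => /hook_two_runs H.
  by case: (posnP x) => [->|x0]; [lia | have := H _ x0; lia].
- apply/negP => /mapP [r]; rewrite mem_iota add0n => /andP [_ rn].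
  rewrite nth_mkseq //.
  by have [k ->] : exists k, n - r = k.+1 by exists (n - r).-1; lia.
- apply/allP => i; rewrite mem_iota => /andP [i1 ilt].
  rewrite !nth_Linf size_nseq.
  have -> : n - (n - i) = i by lia.
  have -> : (n - (n - i).+1).+1 = i by lia.
  rewrite hasNfind ?size_nseq //.
  by apply/hasPn => a /nseqP [-> _] /=; rewrite eqxx.
Qed.

Definition Linf (n : nat) : SDTinf n := Sub (Linf_tab n) (Linf_is_SDTinf n).

(* [min {lam_i | i in I_0}] for [2 <= n]; then [head 0 lam] is [lam_1], which
   takes part in the minimum anyway. *)
Definition min_I0 n (lam : n.-tuple nat) : nat :=
  \big[minn/head 0 lam]_(i < n.-1) tnth lam (cur i).

(* Main.v *)
Require Import Defs.
From mathcomp Require Import all_boot all_order all_algebra.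
From mathcomp Require Import boolp zify.
Import GRing.Theory Num.Theory.

Set Implicit Arguments.
Unset Strict Implicit.
Unset Printing Implicit Defensive.

(** Every tableau of [SDT lam] consists of rows [(n - r)^a k], where the row of
    index [r] starts with its run of the letter [n - r], of length [a]; what
    remains, [k], is the row of index [r] of the _core_ of the tableau.  As the
    shape is fixed, a tableau of [SDT lam] is determined by its core.  The same
    core, with other runs, gives exactly one dual marginally large tableau
    ([fill_marginal_SDTinf]): in such a tableau a run is so much longer than the
    next row that the condition on two consecutive rows holds by itself.  The
    isomorphism is the change of runs, [marginal], and three facts make it one.

    The operators see the core only.  In a tableau of this kind a letter [i] can
    occur only in the rows of index at most [n - i], and the letters [i] of the
    row of index [n - i] are never more numerous than the run of [i + 1] just
    above them ([count_le_run]; otherwise replacing that run by these [i] would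
    give a hook subword longer than the row).  So in the reading word restricted
    to [i] and [i + 1], the part that depends on the lengths of runs is a final
    factor [(i+1)^a i^b] with [b <= a], which does not affect the unmatched [i]
    nor the matching of the letters before it.  Hence the operators act on the
    same box of the core whatever the runs, except that [e_i] may also act on
    the last box of the run of [i + 1] ([tab_f_fill], [tab_e_fill]).  The box
    additions and removals in the definition of the operators of [SDTinf n]
    restore the lengths required ([inf_f_marginal], [inf_e_marginal]).  Whether
    [e_i] has a box left in that run is the only difference between the two
    crystals, and the tensor factor with weight [mu] corrects it: [eps_i] of the
    tensor is [eps_i] of the tableau of shape [lam] ([embed_eps]).

    The set of tableaux is stable under the operators.  A row, and the factor
    made of two consecutive rows, satisfy conditions that only compare the size
    of a row with the maximal length of a hook subword.  This maximal length does
    not change when an operator is applied to a word ([valley_raise] and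
    [valley_lower], where unmatched letters are exchanged for the letters that
    the bracketing rule provides), and an operator acts on a factor of a word as
    itself or not at all.

    The crystal of shape [lam] is connected.  It is enough to join every word to
    a word in which, for all prefixes, the numbers of occurrences of [1, ..., n]
    increase strictly once they are not zero ([word_conn_strict]), because the
    only decomposition tableau with such a reading word is the lowest one
    ([SDT_strict_prefixes]).  If the word has an unmatched [i], apply [f_i].
    Otherwise let [j] be minimal such that some prefix has as many [j] as [j + 1],
    and at least one.  The first [j] can be lowered to [1], the first [j + 1] to
    [2], then [e_1bar] turns this [2] into [1], and both letters can be raised
    again up to [j].  The net effect is that the first [j + 1] has become a [j]
    ([word_conn_lower_first]).  That prefix now has two unmatched [j], so that
    [f_j] applies twice, and the sum of the letters has increased by one; it is
    bounded, hence the procedure stops. *)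

(** * Bracketing *)

(** The number of unmatched [i] and of unmatched [i + 1], after removal of the
    pairs [(i+1, i)], is a morphism from words to the bicyclic monoid; this is its
    product. *)
Definition bracket_mul (x y : nat * nat) : nat * nat :=
  (x.1 + (y.1 - x.2), y.2 + (x.2 - y.1)).

Definition bracket1 (i c : nat) : nat * nat := (nat_of_bool (c == i), nat_of_bool (c == i.+1)).

Fixpoint bracket (i : nat) (w : seq nat) : nat * nat :=
  if w is c :: w' then bracket_mul (bracket1 i c) (bracket i w') else (0, 0).

Lemma bracket_mulA : associative bracket_mul.
Proof. by move=> [a b] [c d] [e f]; rewrite /bracket_mul /=; congr pair; lia. Qed.

Lemma bracket_mul0l x : bracket_mul (0, 0) x = x.
Proof. by case: x => a b; rewrite /bracket_mul /=; congr pair; lia. Qed.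

Lemma bracket_cat i u v : bracket i (u ++ v) = bracket_mul (bracket i u) (bracket i v).
Proof. by elim: u => [|c u IH] /=; rewrite ?bracket_mul0l // IH bracket_mulA. Qed.

Lemma bracket_rcons i u c : bracket i (rcons u c) = bracket_mul (bracket i u) (bracket1 i c).
Proof.
rewrite -cats1 bracket_cat; congr bracket_mul => /=.
by rewrite /bracket1 /bracket_mul /=; congr pair; lia.
Qed.

(** Matched letters come in pairs. *)
Lemma bracket_count i w :
  (bracket i w).1 + count_mem i.+1 w = (bracket i w).2 + count_mem i w.
Proof.
elim: w => [|c w IH] //=; move: IH; case: (bracket i w) => p q /=.
rewrite /bracket_mul /bracket1 /=; lia.
Qed.

Definition pair_letter (i : nat) : pred nat := fun c => (c == i) || (c == i.+1).

Lemma bracket_filter i w : bracket i (filter (pair_letter i) w) = bracket i w.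
Proof.
elim: w => [|c w IH] //=; rewrite /pair_letter; case: ifP => /= h.
  by rewrite IH.
rewrite IH /bracket1; move/norP: h => [/negbTE-> /negbTE->].
by rewrite bracket_mul0l.
Qed.

Lemma bracket_no_letters i w : ~~ has (pair_letter i) w -> bracket i w = (0, 0).
Proof. by rewrite has_filter negbK -bracket_filter => /eqP->. Qed.

Lemma bracket_notinS i w : i.+1 \notin w -> bracket i w = (count_mem i w, 0).
Proof.
elim: w => [|c w IH] //=; rewrite in_cons negb_or => /andP[hc /IH->].
rewrite /bracket_mul /bracket1 /= [c == _]eq_sym [c == i.+1]eq_sym (negbTE hc) /=.
by congr pair; lia.
Qed.

Lemma bracket_nseqS i a : bracket i (nseq a i.+1) = (0, a).
Proof.
elim: a => [|a IH] //=; rewrite IH /bracket_mul /bracket1 /= eqxx.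
congr pair; lia.
Qed.

Lemma letters_rcons i w c :
  letters i (rcons w c) =
  letters i w ++ (if pair_letter i c then [:: (c, size w)] else [::]).
Proof.
have iotaS : iota 0 (size w).+1 = rcons (iota 0 (size w)) (size w).
  by rewrite -addn1 iotaD -cats1.
rewrite /letters size_rcons iotaS zip_rcons ?size_iota //.
by rewrite -cats1 filter_cat /= /pair_letter; case: ifP.
Qed.

(** The condition under which a letter [i] or [i + 1] between [A] and [B] is the
    one that [f_i], respectively [e_i], changes: [A] reduces to a power of [i],
    and [B] to a power of [i + 1]. *)
Definition balanced (i : nat) (A B : seq nat) :=
  (bracket i A).2 = 0 /\ (bracket i B).1 = 0.

(** The stack consists of the unmatched [i + 1], above the unmatched [i].  Only two
    entries matter later: the deepest [i + 1] and the topmost [i]. *)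
Lemma reduce_stackP i w :
  exists Q P : seq (nat * nat),
  [/\ foldl (reduce_step i) [::] (letters i w) = Q ++ P,
      all (fun y => y.1 == i.+1) Q, all (fun y => y.1 == i) P,
      (size P, size Q) = bracket i w &
      (forall Q' y, Q = rcons Q' y -> exists A B,
         [/\ w = A ++ i.+1 :: B, size A = y.2 & balanced i A B]) /\
      (forall P' y, P = y :: P' -> exists A B,
         [/\ w = A ++ i :: B, size A = y.2 & balanced i A B])].
Proof.
elim/last_ind: w => [|w c [Q [P [st Qi Pi szs [lastQ headP]]]]].
  by exists [::], [::]; split => //; split => // [[]].
have ext A B a : w = A ++ a :: B -> rcons w c = A ++ a :: rcons B c.
  by move=> ->; rewrite rcons_cat.
rewrite bracket_rcons letters_rcons foldl_cat st.
have [hc|hc] := boolP (pair_letter i c); last first.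
  exists Q, P; rewrite /= -szs.
  have b0 : bracket1 i c = (0, 0).
    by move/norP: hc; rewrite /bracket1 => -[/negbTE-> /negbTE->].
  split => //; first by rewrite b0 /bracket_mul /=; congr pair; lia.
  split=> [Q' y /lastQ [A [B [wE sA [bA bB]]]]|P' y /headP [A [B [wE sA [bA bB]]]]].
    exists A, (rcons B c); split; rewrite ?(ext _ _ _ wE) //; split=> //.
    by rewrite bracket_rcons b0 /bracket_mul /= bB; lia.
  exists A, (rcons B c); split; rewrite ?(ext _ _ _ wE) //; split=> //.
  by rewrite bracket_rcons b0 /bracket_mul /= bB; lia.
have szQ : (bracket i w).2 = size Q by rewrite -szs.
case/orP: hc => /eqP ->.
  have b1 : bracket1 i i = (1, 0).
    by rewrite /bracket1 eqxx; congr pair; rewrite (_ : i == i.+1 = false) //; lia.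
  case: Q => [|y Q] in st Qi szs lastQ szQ *.
    exists [::], ((i, size w) :: P); rewrite /= eqxx /=; split => //.
    - case: P Pi {st szs headP} => [|[z k] P] //= /andP[/eqP /= -> _].
      by rewrite (_ : i == i.+1 = false) //; lia.
    - by rewrite -szs b1 /bracket_mul /=; congr pair; lia.
    - split; first by case.
      move=> P' y [<- _]; exists w, [::]; split => //; first by rewrite cats1.
  move: Qi; rewrite /= => /andP[/eqP y1 Qi].
  exists Q, P; rewrite y1 !eqxx /=; split => //.
  - by rewrite -szs b1 /bracket_mul /=; congr pair; lia.
  - split=> [Q' z QE|P' z /headP [A [B [wE sA [bA bB]]]]].
      have [|A [B [wE sA [bA bB]]]] := lastQ (y :: Q') z; first by rewrite QE.
      exists A, (rcons B i); split; rewrite ?(ext _ _ _ wE) //.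
        by rewrite wE rcons_cat.
      split=> //; rewrite bracket_rcons b1 /bracket_mul /= bB.
      move: szQ; rewrite wE bracket_cat /= QE size_rcons /bracket_mul /bracket1 /= eqxx bA bB.
      by lia.
    exists A, (rcons B i); split; rewrite ?(ext _ _ _ wE) //.
      by rewrite wE rcons_cat.
    split=> //; rewrite bracket_rcons b1 /bracket_mul /= bB.
    move: szQ; rewrite wE bracket_cat /= /bracket_mul /bracket1 /= eqxx bA bB.
    by lia.
have b1 : bracket1 i i.+1 = (0, 1).
  by rewrite /bracket1 eqxx; congr pair; rewrite (_ : i.+1 == i = false) //; lia.
exists ((i.+1, size w) :: Q), P; rewrite /= eqxx /=; split => //.
- case: (Q ++ P) => [|z s] //=.
  by rewrite (_ : i.+1 == i = false) ?andbF //; lia.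
- by rewrite -szs b1 /bracket_mul /=; congr pair; lia.
- split=> [Q' y|P' y /headP [A [B [wE sA [bA bB]]]]].
    case: (lastP Q) szQ lastQ => [|Q'' z] szQ lastQ.
      case: Q' => [|? []] //= [<-]; exists w, [::].
      by split; rewrite ?cats1.
    rewrite -rcons_cons => /rcons_inj [_ <-].
    have [A [B [wE sA [bA bB]]]] := lastQ _ _ erefl.
    exists A, (rcons B i.+1); split => //; first by rewrite wE rcons_cat.
    by split=> //; rewrite bracket_rcons b1 /bracket_mul /= bB; lia.
  exists A, (rcons B i.+1); split => //; first by rewrite wE rcons_cat.
  by split=> //; rewrite bracket_rcons b1 /bracket_mul /= bB; lia.
Qed.

(** * The operators on tableaux, as changes of one letter *)

Lemma eqS_F i : (i == i.+1) = false. Proof. lia. Qed.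
Lemma eSq_F i : (i.+1 == i) = false. Proof. lia. Qed.

Lemma bracket_mid i A c B : bracket i (A ++ c :: B) =
  bracket_mul (bracket i A) (bracket_mul (bracket1 i c) (bracket i B)).
Proof. by rewrite bracket_cat. Qed.

Lemma cat_cons_lt (A B A' B' : seq nat) c c' :
  A ++ c :: B = A' ++ c' :: B' -> size A < size A' ->
  exists C, A' = A ++ c :: C /\ B = C ++ c' :: B'.
Proof.
elim: A A' => [|a A IH] [|a' A'] //= [-> H] lt; first by exists A'.
by have [C [-> ->]] := IH _ H lt; exists C.
Qed.

(** This and the next lemma show that a word has at most one balanced
    factorization around a letter [i + 1], and at most one around a letter [i]:
    the factor between two candidates would contain both more and fewer [i] than
    [i + 1]. *)
Lemma balanced_open_le i A B A' B' :
  A ++ i.+1 :: B = A' ++ i.+1 :: B' -> balanced i A B -> balanced i A' B' ->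
  size A' <= size A.
Proof.
move=> E [a1 b1] [a2 b2]; rewrite leqNgt; apply/negP => lt.
have [C [A'E BE]] := cat_cons_lt E lt.
move: a2 b1; rewrite A'E BE !bracket_mid /bracket_mul /bracket1 /= eqxx eSq_F b2 a1; lia.
Qed.

Lemma balanced_close_le i A B A' B' :
  A ++ i :: B = A' ++ i :: B' -> balanced i A B -> balanced i A' B' ->
  size A' <= size A.
Proof.
move=> E [a1 b1] [a2 b2]; rewrite leqNgt; apply/negP => lt.
have [C [A'E BE]] := cat_cons_lt E lt.
move: a2 b1; rewrite A'E BE !bracket_mid /bracket_mul /bracket1 /= eqxx eqS_F b2 a1; lia.
Qed.

Lemma reducedP i w :
  exists Q P : seq (nat * nat),
  [/\ [seq y <- reduced i w | y.1 == i.+1] = rev Q,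
      [seq y <- reduced i w | y.1 == i] = rev P,
      (size P, size Q) = bracket i w &
      (forall Q' y, Q = rcons Q' y -> exists A B,
         [/\ w = A ++ i.+1 :: B, size A = y.2 & balanced i A B]) /\
      (forall P' y, P = y :: P' -> exists A B,
         [/\ w = A ++ i :: B, size A = y.2 & balanced i A B])].
Proof.
have [Q [P [st Qi Pi szs H]]] := reduce_stackP i w.
exists Q, P; split => //; rewrite /reduced st filter_rev filter_cat.
  have -> : [seq y <- P | y.1 == i.+1] = [::].
    apply/eqP; rewrite -[_ == _]negbK -has_filter; apply/hasPn => y /(allP Pi).
    by move=> /eqP ->; rewrite eqS_F.
  by rewrite cats0 (all_filterP Qi).
have -> : [seq y <- Q | y.1 == i] = [::].
  apply/eqP; rewrite -[_ == _]negbK -has_filter; apply/hasPn => y /(allP Qi).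
  by move=> /eqP ->; rewrite eSq_F.
by rewrite (all_filterP Pi).
Qed.

Lemma leftmost_openP i w p :
  (exists2 y, ohead [seq y <- reduced i w | y.1 == i.+1] = Some y & y.2 = p) <->
  exists A B, [/\ w = A ++ i.+1 :: B, balanced i A B & size A = p].
Proof.
have [Q [P [-> _ szs [lastQ _]]]] := reducedP i w.
split=> [[y]|[A [B [wE bal <-]]]].
  case/lastP: Q szs lastQ => [|Q z] szs lastQ; first by rewrite /rev.
  rewrite rev_rcons /= => -[<-] <-.
  by have [A [B [wE sA bal]]] := lastQ _ _ erefl; exists A, B.
have : 0 < size Q.
  have -> : size Q = (bracket i w).2 by rewrite -szs.
  case: bal => a b; rewrite wE bracket_mid /bracket_mul /bracket1 /= eqxx b; lia.
case/lastP: Q szs lastQ => [|Q z] szs lastQ // _.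
have [A' [B' [wE' sA' bal']]] := lastQ _ _ erefl.
exists z; first by rewrite rev_rcons.
rewrite -sA'; apply/eqP; rewrite eqn_leq; apply/andP; split.
  by apply: (balanced_open_le _ bal bal'); rewrite -wE.
by apply: (balanced_open_le _ bal' bal); rewrite -wE'.
Qed.

Lemma rightmost_closeP i w p :
  (exists2 y, ohead (rev [seq y <- reduced i w | y.1 == i]) = Some y & y.2 = p) <->
  exists A B, [/\ w = A ++ i :: B, balanced i A B & size A = p].
Proof.
have [Q [P [_ -> szs [_ headP]]]] := reducedP i w; rewrite revK.
split=> [[y]|[A [B [wE bal <-]]]].
  case: P szs headP => [|z P] szs headP //= [<-] <-.
  by have [A [B [wE sA bal]]] := headP _ _ erefl; exists A, B.
have : 0 < size P.
  have -> : size P = (bracket i w).1 by rewrite -szs.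
  case: bal => a b; rewrite wE bracket_mid /bracket_mul /bracket1 /= eqxx; lia.
case: P szs headP => [|z P] szs headP // _.
have [A' [B' [wE' sA' bal']]] := headP _ _ erefl.
exists z => //.
rewrite -sA'; apply/eqP; rewrite eqn_leq; apply/andP; split.
  by apply: (balanced_close_le _ bal bal'); rewrite -wE.
by apply: (balanced_close_le _ bal' bal); rewrite -wE'.
Qed.

Lemma ohead_letters i w :
  match ohead (letters i w) with
  | Some y => exists A B, [/\ w = A ++ y.1 :: B, ~~ has (pair_letter i) A,
                pair_letter i y.1 & y.2 = size A]
  | None => ~~ has (pair_letter i) w
  end.
Proof.
elim/last_ind: w => [|w c] //=.
rewrite letters_rcons -cats1.
case: (letters i w) => [|y s] /=.
  move=> H; case: ifP => /= hc; first by exists w, [::].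
  by rewrite has_cat negb_or H /= hc.
move=> [A [B [-> hA hy yE]]]; exists A, (B ++ [:: c]).
by rewrite -catA.
Qed.

Lemma first_letterP i w p c : pair_letter i c ->
  (ohead (letters i w) = Some (c, p)) <->
  exists A B, [/\ w = A ++ c :: B, ~~ has (pair_letter i) A & size A = p].
Proof.
move=> hc; have := ohead_letters i w.
case: ohead => [[c' p']|] /= H; last first.
  by split => // -[A [B [wE _ _]]]; move: H; rewrite wE has_cat /= hc /= orbT.
case: H => A' [B' [wE' hA' hc' pE']].
split=> [[<- <-]|[A [B [wE hA sA]]]]; first by exists A', B'.
have sAA : size A = size A'.
  rewrite wE in wE'; have [lt|lt|//] := ltngtP (size A) (size A').
    have [C [AE _]] := cat_cons_lt wE' lt.
    by move: hA'; rewrite AE has_cat /= hc orbT.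
  have [C [AE _]] := cat_cons_lt (esym wE') lt.
  by move: hA; rewrite AE has_cat /= hc' orbT.
move/eqP: wE; rewrite wE' eqseq_cat // => /andP[_ /eqP [-> _]].
by rewrite pE' -sA sAA.
Qed.

(** Every operator exchanges two letters, for the odd ones [1] and [2]. *)
Definition hi n (x : qindex n) := (prime_index x).+1.
Definition lo n (x : qindex n) := prime_index x.

(** The position between [A] and [B] is the one on which the operators of index
    [x] act. *)
Definition active n (x : qindex n) (A B : seq nat) : Prop :=
  if x is Even i then balanced i.+1 A B else ~~ has (pair_letter 1) A.

Lemma tab_eP n (x : qindex n) T T' :
  tab_e x T = Some T' <->
  exists A B, [/\ rd T = A ++ hi x :: B, active x A B & T' = change T (size A) (lo x)].
Proof.
rewrite /hi /lo; case: x => [i|] /=.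
  split=> [|[A [B [wE bal ->]]]].
    case E: ohead => [y|] //= [<-].
    have /leftmost_openP [A [B [wE bal <-]]] : exists2 z,
      ohead [seq y <- reduced i.+1 (rd T) | y.1 == i.+2] = Some z & z.2 = y.2.
      by exists y.
    by exists A, B.
  have /leftmost_openP [y -> <-//] : exists A' B',
    [/\ rd T = A' ++ i.+2 :: B', balanced i.+1 A' B' & size A' = size A].
  by exists A, B.
split=> [|[A [B [wE bal ->]]]].
  case E: ohead => [[c p]|] //=; case: eqP => // c2 [<-]; rewrite {c}c2 in E.
  have /(first_letterP (i := 1)) := E; case=> // A [B [wE hA <-]].
  by exists A, B.
have -> : ohead (letters 1 (rd T)) = Some (2, size A).
  by apply/first_letterP => //; exists A, B.
by [].
Qed.

Lemma tab_fP n (x : qindex n) T T' :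
  tab_f x T = Some T' <->
  exists A B, [/\ rd T = A ++ lo x :: B, active x A B & T' = change T (size A) (hi x)].
Proof.
rewrite /hi /lo; case: x => [i|] /=.
  split=> [|[A [B [wE bal ->]]]].
    case E: ohead => [y|] //= [<-].
    have /rightmost_closeP [A [B [wE bal <-]]] : exists2 z,
      ohead (rev [seq y <- reduced i.+1 (rd T) | y.1 == i.+1]) = Some z & z.2 = y.2.
      by exists y.
    by exists A, B.
  have /rightmost_closeP [y -> <-//] : exists A' B',
    [/\ rd T = A' ++ i.+1 :: B', balanced i.+1 A' B' & size A' = size A].
  by exists A, B.
split=> [|[A [B [wE bal ->]]]].
  case E: ohead => [[c p]|] //=; case: eqP => // c2 [<-]; rewrite {c}c2 in E.
  have /(first_letterP (i := 1)) := E; case=> // A [B [wE hA <-]].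
  by exists A, B.
have -> : ohead (letters 1 (rd T)) = Some (1, size A).
  by apply/first_letterP => //; exists A, B.
by [].
Qed.

Lemma tab_epsE n (i : 'I_n.-1) T : tab_eps i T = (bracket i.+1 (rd T)).2.
Proof.
have [Q [P [E _ <- _]]] := reducedP i.+1 (rd T).
by rewrite /tab_eps -size_filter E size_rev.
Qed.

Lemma tab_phiE n (i : 'I_n.-1) T : tab_phi i T = (bracket i.+1 (rd T)).1.
Proof.
have [Q [P [_ E <- _]]] := reducedP i.+1 (rd T).
by rewrite /tab_phi -size_filter E size_rev.
Qed.

Lemma rd_cat T1 T2 : rd (T1 ++ T2) = rd T1 ++ rd T2.
Proof. by rewrite /rd map_cat flatten_cat. Qed.

Lemma rd_cons v T : rd (v :: T) = rev v ++ rd T.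
Proof. by []. Qed.

Lemma rd_box T1 v1 c v2 T2 :
  rd (T1 ++ (v1 ++ c :: v2) :: T2) = (rd T1 ++ rev v2) ++ c :: (rev v1 ++ rd T2).
Proof. by rewrite rd_cat rd_cons rev_cat rev_cons cat_rcons -!catA. Qed.

Lemma reshape_rd (T T' : tableau) : shape T' = shape T ->
  [seq rev v | v <- reshape (shape T) (rd T')] = T'.
Proof.
move=> <-; have -> : shape T' = shape (map rev T').
  by rewrite /shape -map_comp; apply: eq_map => v /=; rewrite size_rev.
by rewrite flattenK -map_comp map_id_in // => v _ /=; rewrite revK.
Qed.

Lemma changeE T1 v1 c v2 T2 p a : p = size (rd T1 ++ rev v2) ->
  change (T1 ++ (v1 ++ c :: v2) :: T2) p a = T1 ++ (v1 ++ a :: v2) :: T2.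
Proof.
move=> ->; rewrite /change rd_box.
have -> : set_nth 0 ((rd T1 ++ rev v2) ++ c :: (rev v1 ++ rd T2)) (size (rd T1 ++ rev v2)) a
  = rd (T1 ++ (v1 ++ a :: v2) :: T2).
  rewrite rd_box; elim: (rd T1 ++ rev v2) => [|d s IH] //=.
  by rewrite IH.
by apply: reshape_rd; rewrite /shape !map_cat /= !size_cat.
Qed.

(** A position in the reading word is a box: the rows above it are read before,
    as well as the boxes of its own row that are on its right. *)
Lemma boxP T A c B : rd T = A ++ c :: B ->
  exists T1 v1 v2 T2, [/\ T = T1 ++ (v1 ++ c :: v2) :: T2,
    A = rd T1 ++ rev v2 & B = rev v1 ++ rd T2].
Proof.
elim: T A => [|v T IH] A; first by case: A.
rewrite rd_cons => E.
have [lt|le] := ltnP (size A) (size v).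
  exists [::], (rev (drop (size A).+1 (rev v))), (rev A), T.
  have revE : rev v = A ++ c :: drop (size A).+1 (rev v).
    rewrite -{1}(cat_take_drop (size A) (rev v)).
    move: E; rewrite -{1}(cat_take_drop (size A) (rev v)) -catA => /eqP.
    rewrite eqseq_cat ?size_takel ?size_rev ?(ltnW lt) // => /andP[/eqP -> /eqP].
    rewrite (drop_nth 0) ?size_rev //= => -[-> _] //.
  split; rewrite /= ?revK //.
    by rewrite -[LHS]/([:: _] ++ T) -{1}(revK v) {1}revE rev_cat rev_cons cat_rcons.
  move/eqP: E; rewrite {1}revE -catA eqseq_cat // => /andP[_ /eqP [->]].
  by [].
have [A' AE] : exists A', A = rev v ++ A'.
  exists (drop (size v) A).
  move: E; rewrite -{1 2}(cat_take_drop (size v) A) -catA => /eqP.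
  rewrite eqseq_cat ?size_takel ?size_rev // => /andP[/eqP -> _].
  by [].
move: E; rewrite AE -catA => /eqP; rewrite eqseq_cat // eqxx /= => /eqP E.
have [T1 [v1 [v2 [T2 [-> -> ->]]]]] := IH _ E.
by exists (v :: T1), v1, v2, T2; rewrite rd_cons catA.
Qed.

(** * Hook subwords of maximal length *)

(** Reading words run from right to left, which turns hook words into these.
    Nothing is asked at the junction: if [D] ends with a letter that is at most
    the first of [E], this letter can be moved to [E]. *)
Definition valley (s : seq nat) : Prop :=
  exists D E, [/\ s = D ++ E, pairwise gtn D & pairwise leq E].

Lemma gtn_trans : transitive gtn.
Proof. by move=> y x z /= yx zy; apply: ltn_trans yx. Qed.

Lemma valley_bottom s : valley s -> s <> [::] ->
  exists D m E, [/\ s = D ++ m :: E, pairwise gtn (rcons D m) & pairwise leq (m :: E)].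
Proof.
case=> D [[|e E] [-> dD iE]].
  case/lastP: D dD => [|D d] dD s0; first by case: s0.
  by exists D, d, [::]; split; rewrite // cats0 cats1.
case/lastP: D dD => [|D d] dD _; first by exists [::], e, E.
have [de|ed] := leqP d e.
  exists D, d, (e :: E); split => //; first by rewrite cat_rcons.
  rewrite pairwise_cons iE andbT /= de.
  move: iE => /= /andP[/allP iE _]; apply/allP => x /iE /=; exact: leq_trans.
exists (rcons D d), e, E; split => //.
rewrite pairwise_rcons dD andbT; move: dD; rewrite pairwise_rcons.
rewrite all_rcons /= ed => /andP[/allP H _] /=.
by apply/allP => x /H /=; apply: ltn_trans.
Qed.

Lemma hook_wordE u : hook_word u <-> u <> [::] /\ valley (rev u).
Proof.
have sle s : sorted geq s = pairwise leq (rev s).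
  by rewrite -(sorted_pairwise leq_trans) rev_sorted.
have slt s : sorted ltn s = pairwise gtn (rev s).
  by rewrite -(sorted_pairwise gtn_trans) rev_sorted.
split=> [/existsP [[k klt] /= /andP [dec inc]]|[u0 /valley_bottom]].
  split; first by case: (u) klt.
  exists (rev (drop k.+1 u)), (rev (take k.+1 u)); split; last by rewrite -sle.
    by rewrite -rev_cat cat_take_drop.
  rewrite -slt; move: inc; rewrite (drop_nth 0) //=; exact: path_sorted.
case=> [/(congr1 rev)|D [m [E [uE dD iE]]]]; first by rewrite revK.
have {}uE : u = rev E ++ m :: rev D by rewrite -cat_rcons -rev_cons -rev_cat -uE revK.
have klt : size E < size u by rewrite uE size_cat /= size_rev; lia.
apply/existsP; exists (Ordinal klt) => /=; rewrite sle slt.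
rewrite uE -cat_rcons take_size_cat ?size_rcons ?size_rev //.
rewrite rev_rcons revK iE /= cat_rcons drop_size_cat ?size_rev //.
by rewrite rev_cons revK.
Qed.

Lemma row_okP u v : row_ok u v <-> v = [::] \/
  (valley (rev v) /\ forall s, subseq s (rev v ++ rev u) -> valley s -> size s <= size v).
Proof.
rewrite /row_ok; case: (v =P [::]) => [->|v0] /=; first by split => // _; left.
split=> [/andP[/hook_wordE [_ hv] /forallP H]|[//|[hv H]]].
  right; split=> // s; rewrite -rev_cat => /subseqP [m szm sE] vs.
  case: (s =P [::]) => [->//|s0].
  have szm' : size (rev m) == size (u ++ v) by rewrite size_rev szm size_rev.
  have := H (Tuple szm') => /=.
  have -> : mask (rev m) (u ++ v) = rev s.
    by rewrite sE rev_mask ?revK // szm.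
  rewrite size_rev => /implyP; apply; apply/hook_wordE; rewrite revK; split => //.
  by move/(congr1 rev); rewrite revK.
apply/andP; split; first by apply/hook_wordE.
apply/forallP => m; apply/implyP => /hook_wordE [_ hm].
rewrite -[X in X <= _]size_rev; apply: H => //.
rewrite -rev_cat subseq_rev; exact: mask_subseq.
Qed.

Lemma subseq_catP (x y B : seq nat) : subseq (x ++ y) B ->
  exists B1 B2, [/\ B = B1 ++ B2, subseq x B1 & subseq y B2].
Proof.
elim: B x => [|b B IH] [|a x] /=.
- by move=> H; exists [::], [::].
- by [].
- by move=> H; exists [::], (b :: B).
case: eqP => [->|ab].
  move=> /IH [B1 [B2 [-> H1 H2]]].
  by exists (b :: B1), B2; split => //=; rewrite eqxx.
move=> /(IH (a :: x)) [B1 [B2 [-> H1 H2]]].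
by exists (b :: B1), B2; split => //=; case: eqP.
Qed.

Lemma subseq_cat_consP (s A B : seq nat) c : subseq s (A ++ c :: B) ->
  subseq s (A ++ B) \/
  exists sA sB, [/\ s = sA ++ c :: sB, subseq sA A & subseq sB B].
Proof.
elim: A s => [|a A IH] [|x s] /=; rewrite ?sub0seq; try by left.
  have [->|_] := eqVneq x c => H; last by left.
  by right; exists [::], s.
have [->|xa] := eqVneq x a.
  move=> /IH [H|[sA [sB [E HA HB]]]]; first by left.
  by right; exists (a :: sA), sB; rewrite /= eqxx E.
move=> /(IH (x :: s)) [H|[sA [sB [E HA HB]]]]; first by left.
right; exists sA, sB; split => //.
exact: (subseq_trans HA (subseq_cons A a)).
Qed.

Lemma subseq_nseq c a (B : seq nat) : subseq (nseq c a) B = (c <= count_mem a B).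
Proof.
elim: B c => [|b B IH] [|c] //=; rewrite ?sub0seq //.
case: (eqVneq a b) IH => [->|ab] IH; first by rewrite IH.
by rewrite -[a :: nseq c a]/(nseq c.+1 a) IH.
Qed.

Lemma bracket_suffix_count i A1 A2 :
  (bracket i (A1 ++ A2)).2 = 0 -> count_mem i.+1 A2 <= count_mem i A2.
Proof. by have := bracket_count i A2; rewrite bracket_cat /bracket_mul /=; lia. Qed.

Lemma bracket_prefix_count i B1 B2 :
  (bracket i (B1 ++ B2)).1 = 0 -> count_mem i B1 <= count_mem i.+1 B1.
Proof. by have := bracket_count i B1; rewrite bracket_cat /bracket_mul /=; lia. Qed.

Lemma cat_cons_eq (D E sA sB : seq nat) c : D ++ E = sA ++ c :: sB ->
  (exists2 D2, D = sA ++ c :: D2 & sB = D2 ++ E) \/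
  (exists2 E1, E = E1 ++ c :: sB & sA = D ++ E1).
Proof.
elim: D sA => [|d D IH] [|a sA] /=.
- by move=> ->; right; exists [::].
- by move=> ->; right; exists (a :: sA).
- by move=> [-> <-]; left; exists D.
- move=> [-> /IH [[D2 -> ->]|[E1 -> ->]]]; [left; by exists D2|right; by exists E1].
Qed.

Lemma split_leading_run i s : pairwise leq s -> all (leq i) s ->
  exists c r, s = nseq c i ++ r /\ all (leq i.+1) r.
Proof.
elim: s => [|a s IH] /=; first by exists 0, [::].
move=> /andP[/allP as_ /IH{}IH] /andP[ia /IH [c [r [sE rE]]]].
case: (a =P i) => [->|ai].
  by exists c.+1, r; rewrite sE.
exists 0, (a :: s); split => //=; apply/andP; split; first by lia.
by apply/allP => x /as_ /=; lia.
Qed.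

Lemma split_trailing_run i s : pairwise leq s -> all (geq i) s ->
  exists r c, s = r ++ nseq c i /\ all (gtn i) r.
Proof.
elim/last_ind: s => [|s a IH]; first by exists [::], 0.
rewrite pairwise_rcons all_rcons => /andP[/allP as_ ps] /andP[/= ia ls].
case: (a =P i) => [->|ai].
  have [r [c [sE rE]]] := IH ps ls.
  exists r, c.+1; rewrite sE -cats1 -catA; split => //.
  by congr cat; rewrite -(nseqD c 1) addn1.
exists (rcons s a), 0; rewrite cats0; split => //; rewrite all_rcons /=.
by apply/andP; split; [lia|apply/allP => x /as_ /=; lia].
Qed.

Definition positive (s : seq nat) := all (leq 1) s.

(** In the four lemmas that follow, a subword that uses some letters [i + 1]
    (respectively [i]) of a word without unmatched ones is changed with the help
    of the letters to which they are matched. *)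
Lemma match_open_last i (s A : seq nat) : (bracket i A).2 = 0 ->
  subseq (rcons s i.+1) A -> subseq (rcons (rcons s i.+1) i) A.
Proof.
move=> bA; rewrite -cats1 => /subseq_catP [A1 [A2 [AE s1]]].
rewrite sub1seq => /path.splitPr H; case: H AE => P Q AE.
have H : count_mem i.+1 (i.+1 :: Q) <= count_mem i (i.+1 :: Q).
  by apply: (@bracket_suffix_count i (A1 ++ P)); rewrite // -catA -AE.
have iQ : i \in Q.
  by rewrite -has_pred1 has_count; move: H; rewrite /= eqxx eSq_F; lia.
rewrite AE -!cats1 -catA; apply: cat_subseq => //=.
apply: subseq_trans (suffix_subseq P _).
by rewrite /= eqxx sub1seq.
Qed.

Lemma match_close_head i (s B : seq nat) : (bracket i B).1 = 0 ->
  subseq (i :: s) B -> subseq (i.+1 :: i :: s) B.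
Proof.
move=> bB; rewrite -cat1s => /subseq_catP [B1 [B2 [BE]]].
rewrite sub1seq => /path.splitPr H s2; case: H BE => P Q BE.
have H : count_mem i (rcons P i) <= count_mem i.+1 (rcons P i).
  by apply: (@bracket_prefix_count i _ (Q ++ B2)); rewrite // cat_rcons -cat_cons catA -BE.
have iP : i.+1 \in P.
  move: H; rewrite -cats1 !count_cat /= eqxx eqS_F -has_pred1 has_count /=; lia.
rewrite BE -cat_rcons -!catA -[i.+1 :: i :: s]/([:: i.+1] ++ [:: i] ++ s) -cats1 -!catA.
apply: cat_subseq; first by rewrite sub1seq.
apply: cat_subseq; first by rewrite sub1seq mem_seq1.
exact: subseq_trans s2 (suffix_subseq _ _).
Qed.

Lemma match_open_run i d (s A : seq nat) : (bracket i A).2 = 0 ->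
  subseq (s ++ nseq d i.+1) A -> subseq (s ++ nseq d i) A.
Proof.
move=> bA /subseq_catP [A1 [A2 [AE s1]]]; rewrite subseq_nseq => dA.
have H : count_mem i.+1 A2 <= count_mem i A2.
  by apply: (@bracket_suffix_count i A1); rewrite // -AE.
by rewrite AE; apply: cat_subseq => //; rewrite subseq_nseq; apply: leq_trans H.
Qed.

Lemma match_close_run i c (s B : seq nat) : (bracket i B).1 = 0 ->
  subseq (nseq c i ++ s) B -> subseq (nseq c i.+1 ++ s) B.
Proof.
move=> bB /subseq_catP [B1 [B2 [BE]]]; rewrite subseq_nseq => cB s2.
have H : count_mem i B1 <= count_mem i.+1 B1.
  by apply: (@bracket_prefix_count i _ B2); rewrite // -BE.
by rewrite BE; apply: cat_subseq => //; rewrite subseq_nseq; apply: leq_trans H.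
Qed.

Lemma decreasing_next i (s D : seq nat) : pairwise gtn (s ++ i :: D) ->
  i.+1 \in s -> exists s', s = rcons s' i.+1.
Proof.
case/lastP: s => [|s z] //; rewrite mem_rcons in_cons => dD /predU1P [->|zs].
  by exists s.
move: dD; rewrite cat_rcons pairwise_cat => /and3P[/allrelP g _] /= /andP[/andP[zi _] _].
have := g _ _ zs (mem_head _ _); rewrite /=; lia.
Qed.

Lemma mem_no_pair i c A : ~~ has (pair_letter i) A -> c \in A -> c != i /\ c != i.+1.
Proof. by move=> /hasPn H /H; rewrite /pair_letter negb_or => /andP. Qed.

(** Applying [f] to a word does not shorten its longest valley subword.  If the
    new letter [i + 1] clashes with an earlier [i + 1] in the decreasing part,
    then the latter is matched to an [i] that can be used in place of the lost
    one.  If it clashes with later letters [i] in the increasing part, then these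
    are replaced by the letters [i + 1] to which they are matched. *)
Lemma valley_raise n (x : qindex n) A B s :
  active x A B -> positive (A ++ B) ->
  subseq s (A ++ lo x :: B) -> valley s ->
  exists s', [/\ subseq s' (A ++ hi x :: B), valley s' & size s' = size s].
Proof.
move=> act pos /subseq_cat_consP [sub|[sA [sB [sE subA subB]]]].
  move=> vs; exists s; split=> //; apply: subseq_trans sub _.
  by apply: cat_subseq => //; apply: subseq_cons.
rewrite sE => vs; case: (vs) => D [E [/esym/cat_cons_eq H dD iE]].
have sub' u v : subseq u A -> subseq v B -> subseq (u ++ hi x :: v) (A ++ hi x :: B).
  by move=> uA vB; apply: cat_subseq => //=; rewrite eqxx.
case: H => [[D2 DE sBE]|[E1 EE sAE]].
  (* The letter is in the decreasing part. *)
  have [hisA|hisA] := boolP (hi x \in sA); last first.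
    exists (sA ++ hi x :: sB); split; [exact: sub'| |by rewrite !size_cat].
    exists (sA ++ hi x :: D2), E; split => //; first by rewrite -catA sBE.
    move: dD hisA; rewrite DE !pairwise_cat /= !allrel_consr.
    move=> /and3P[/andP[g1 ->] -> /andP[g2 ->]] hisA.
    rewrite !andbT /=; apply/andP; split.
      apply/allP => z zs; have /= := allP g1 _ zs.
      have : z != hi x by apply: contraNneq hisA => <-.
      by rewrite /hi /lo; lia.
    by apply/allP => z /(allP g2) /=; rewrite /hi /lo; lia.
  case: x act sub' hisA DE dD sE vs => [i|] act sub' hisA DE dD sE vs; last first.
    by have [_] := mem_no_pair act (mem_subseq subA hisA); rewrite eqxx.
  move: act => /= [bA bB].
  have [sA1 sAE] : exists s', sA = rcons s' i.+2 by apply: (@decreasing_next i.+1 _ D2); rewrite -?DE.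
  exists (sA ++ i.+1 :: sB); split => //.
  rewrite -cat_rcons; apply: cat_subseq; last exact: subseq_trans subB (subseq_cons _ _).
  by move: subA; rewrite sAE; apply: match_open_last.
move: iE; rewrite EE pairwise_cat => /and3P[/allrelP le1 iE1 /= /andP[le2 iE2]].
case: x act sub' EE vs sE le1 le2 => [i|] act sub' EE vs sE le1 le2; last first.
  have E1E : E1 = [::].
    case: E1 sAE le1 {EE iE1} => // z E1 sAE le1.
    have zA : z \in A by apply: (mem_subseq subA); rewrite sAE mem_cat mem_head orbT.
    have := le1 z 1 (mem_head _ _) (mem_head _ _) => /=.
    have := allP pos z; rewrite mem_cat zA /= => /(_ isT).
    by have [] := mem_no_pair act zA; lia.
  exists (sA ++ 2 :: sB); split; [exact: sub'| |by rewrite !size_cat].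
  exists (rcons D 2), sB; split => //; first by rewrite sAE E1E cats0 cat_rcons.
  rewrite pairwise_rcons dD andbT; apply/allP => z zD /=.
  have zA : z \in A by apply: (mem_subseq subA); rewrite sAE mem_cat zD.
  have := allP pos z; rewrite mem_cat zA /= => /(_ isT).
  by have [] := mem_no_pair act zA; lia.
move: act => /= [bA bB].
have [c [r [sBE rE]]] := split_leading_run iE2 le2.
exists (sA ++ i.+2 :: (nseq c i.+2 ++ r)); split.
- by apply: sub' => //; move: subB; rewrite sBE; apply: match_close_run.
- exists D, (E1 ++ i.+2 :: (nseq c i.+2 ++ r)); split => //; first by rewrite catA -sAE.
  rewrite -[i.+2 :: _ ++ r]/(nseq c.+1 i.+2 ++ r) !pairwise_cat iE1 /=.
  move: iE2; rewrite sBE pairwise_cat => /and3P[_ _ ->]; rewrite andbT.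
  apply/and3P; split.
  + apply/allrelP => a b aE; have ai := le1 a _ aE (mem_head _ _); rewrite /lo /= in ai.
    rewrite in_cons mem_cat => /or3P[/eqP->|/nseqP[-> _]|/(allP rE)] /=; lia.
  + apply/andP; split; first exact: rE.
    by apply/allrelP => a b /nseqP[-> _] /(allP rE).
  + apply/andP; split; first by apply/allP => a /nseqP[->].
    by apply/(pairwiseP 0) => a b; rewrite !inE size_nseq => ac bc _; rewrite !nth_nseq ac bc.
- by rewrite !size_cat /= sBE !size_cat !size_nseq.
Qed.

(** The converse, for [e].  For [e_1bar] the new letter [1], being minimal, can
    always serve as the beginning of the increasing part. *)
Lemma valley_lower n (x : qindex n) A B s :
  active x A B -> positive (A ++ B) ->
  subseq s (A ++ hi x :: B) -> valley s ->
  exists s', [/\ subseq s' (A ++ lo x :: B), valley s' & size s' = size s].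
Proof.
move=> act pos /subseq_cat_consP [sub|[sA [sB [sE subA subB]]]].
  move=> vs; exists s; split=> //; apply: subseq_trans sub _.
  by apply: cat_subseq => //; apply: subseq_cons.
rewrite sE => vs; case: (vs) => D [E [/esym/cat_cons_eq H dD iE]].
have sub' u v : subseq u A -> subseq v B -> subseq (u ++ lo x :: v) (A ++ lo x :: B).
  by move=> uA vB; apply: cat_subseq => //=; rewrite eqxx.
have pos' z t : subseq t A \/ subseq t B -> z \in t -> 0 < z.
  by move=> [/mem_subseq Hs|/mem_subseq Hs] /Hs zA; apply: (allP pos); rewrite mem_cat zA ?orbT.
case: H => [[D2 DE sBE]|[E1 EE sAE]].
  case: x act sub' DE dD sE vs => [i|] act sub' DE dD sE vs.
    move: act => /= [bA bB].
    have [loD|loD] := boolP (i.+1 \in D2); last first.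
      exists (sA ++ i.+1 :: sB); split; [exact: sub'| |by rewrite !size_cat].
      exists (sA ++ i.+1 :: D2), E; split => //; first by rewrite -catA sBE.
      move: dD loD; rewrite DE !pairwise_cat /= !allrel_consr.
      move=> /and3P[/andP[g1 ->] -> /andP[g2 ->]] loD.
      rewrite !andbT /=; apply/andP; split.
        by apply/allP => z /(allP g1) /=; rewrite /hi /=; lia.
      apply/allP => z zs; have /= := allP g2 _ zs.
      have : z != i.+1 by apply: contraNneq loD => <-.
      by rewrite /hi /=; lia.
    exists (sA ++ i.+2 :: sB); split => //.
    apply: cat_subseq => //; apply: subseq_trans (subseq_cons _ _).
    have [D3 D2E] : exists D3, D2 = i.+1 :: D3.
      case: D2 loD DE {sBE} => // z D3 loD DE.
      move: loD; rewrite in_cons => /predU1P [<-|zD]; first by exists D3.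
      move: dD; rewrite DE pairwise_cat => /and3P[_ _] /= /andP[/andP[zi _] /andP[/allP/(_ _ zD) /= g _]].
      by move: zi g; rewrite /hi /=; lia.
    by move: subB; rewrite sBE D2E /=; apply: match_close_head.
  exists (sA ++ 1 :: sB); split; [exact: sub'| |by rewrite !size_cat].
  exists sA, (1 :: sB); split => //.
    by move: dD; rewrite DE pairwise_cat => /and3P[].
  rewrite /=; apply/andP; split.
    by apply/allP => z zB; apply: (pos' _ sB) => //; right.
  rewrite sBE pairwise_cat iE andbT.
  have D21 : all (pred1 1) D2.
    apply/allP => z zD; move: dD; rewrite DE pairwise_cat => /and3P[_ _] /= /andP[/allP/(_ _ zD) /= z2 _].
    have : 0 < z by apply: (pos' _ sB); [right|rewrite sBE mem_cat zD].
    by rewrite /hi /= in z2; lia.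
  apply/andP; split.
    apply/allrelP => a b /(allP D21) /= /eqP -> bE.
    by apply: (pos' _ sB); [right|rewrite sBE mem_cat bE orbT].
  apply/(pairwiseP 0) => a b aD bD _.
  by rewrite (eqP (allP D21 _ (mem_nth 0 aD))) (eqP (allP D21 _ (mem_nth 0 bD))).
move: iE; rewrite EE pairwise_cat => /and3P[/allrelP le1 iE1 /= /andP[le2 iE2]].
case: x act sub' EE vs sE le1 le2 => [i|] act sub' EE vs sE le1 le2; last first.
  have E1E : E1 = [::].
    case: E1 sAE le1 {EE iE1} => // z E1 sAE le1.
    have zs : z \in sA by rewrite sAE mem_cat mem_head orbT.
    have := le1 z 2 (mem_head _ _) (mem_head _ _) => /=.
    have := pos' z sA (or_introl subA) zs.
    by have [] := mem_no_pair act (mem_subseq subA zs); lia.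
  exists (sA ++ 1 :: sB); split; [exact: sub'| |by rewrite !size_cat].
  exists D, (1 :: sB); split => //; first by rewrite sAE E1E cats0.
  rewrite /= iE2 andbT.
  by apply/allP => z zB; apply: (pos' _ sB) => //; right.
move: act => /= [bA bB].
have le1' : all (geq i.+2) E1 by apply/allP => z zE; apply: le1 => //; apply: mem_head.
have [r [d [E1E rE]]] := split_trailing_run iE1 le1'.
exists ((D ++ r ++ nseq d i.+1) ++ i.+1 :: sB); split.
- by apply: sub' => //; rewrite catA; apply: match_open_run; rewrite // -catA -E1E -sAE.
- exists D, ((r ++ nseq d i.+1) ++ i.+1 :: sB); split => //; first by rewrite -catA.
  rewrite -catA -cat_rcons -[rcons _ _]/(rcons (nseq d i.+1) i.+1).
  have -> : rcons (nseq d i.+1) i.+1 = nseq d.+1 i.+1.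
    by rewrite -cats1 -(nseqD d 1) addn1.
  move: iE1; rewrite E1E !pairwise_cat => /and3P[_ -> _] /=; rewrite iE2 andbT.
  apply/andP; split.
    apply/allrelP => a b /(allP rE) /= ai; rewrite in_cons mem_cat.
    move=> /or3P[/eqP->|/nseqP[-> _]|/(allP le2)] /=; rewrite /hi /=; lia.
  apply/and3P; split.
  + apply/andP; split; first by apply/allP => b /(allP le2) /=; rewrite /hi /=; lia.
    by apply/allrelP => a b /nseqP[-> _] /(allP le2) /=; rewrite /hi /=; lia.
  + by apply/allP => a /nseqP[->].
  + by apply/(pairwiseP 0) => a b; rewrite !inE size_nseq => ac bc _; rewrite !nth_nseq ac bc.
- by rewrite !size_cat /= sAE E1E !size_cat !size_nseq; lia.
Qed.

(** * Decomposition tableaux are stable under the operators *)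

Lemma is_SDTP n T : is_SDT n T <->
  [/\ LambdaMinus n (shape T), all (all (fun a => 1 <= a <= n)) T &
      forall r, r < n -> row_ok (nth [::] T r.+1) (nth [::] T r)].
Proof.
split=> [/and3P[h1 h2 /allP h3]|[h1 h2 h3]].
  by split=> // r rn; apply: h3; rewrite mem_iota.
by apply/and3P; split => //; apply/allP => r; rewrite mem_iota => /andP[_]; apply: h3.
Qed.

Lemma SDT_size n T : is_SDT n T -> size T = n.
Proof. by move=> /is_SDTP [/andP[/eqP <- _] _ _]; rewrite size_map. Qed.

Lemma row_valley u v : row_ok u v -> valley (rev v).
Proof.
case/row_okP => [->|[]//]; by exists [::], [::].
Qed.

Lemma row_max u v s : row_ok u v -> v <> [::] -> subseq s (rev v ++ rev u) ->
  valley s -> size s <= size v.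
Proof. by move=> /row_okP [//|[_ H]] _; apply: H. Qed.

Definition transfer c a (A B : seq nat) := forall s, subseq s (A ++ c :: B) ->
  valley s -> exists s', [/\ subseq s' (A ++ a :: B), valley s' & size s' = size s].

Lemma transfer_valley c a A B : transfer c a A B ->
  valley (A ++ c :: B) -> valley (A ++ a :: B).
Proof.
move=> H /(H _ (subseq_refl _)) [s' [sub vs sz]].
suff <- : s' = A ++ a :: B by [].
apply/eqP; rewrite -(size_subseq_leqif sub) sz !size_cat //.
Qed.

(** An operator acts on a factor of a word as itself, or trivially. *)
Lemma active_factor n (x : qindex n) X A B Z :
  active x (X ++ A) (B ++ Z) -> active x A B.
Proof.
case: x => [i|] /=; last by rewrite has_cat => /norP[].
by rewrite /balanced !bracket_cat /bracket_mul /=; lia.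
Qed.

(** The conditions on a row and on two consecutive rows concern the factors of the
    reading word that they form, and are preserved as soon as the change of the
    letter preserves the length of the longest valley subwords of factors. *)
Lemma SDT_change n T1 v1 c v2 T2 a :
  is_SDT n (T1 ++ (v1 ++ c :: v2) :: T2) -> 1 <= a <= n ->
  (forall X A B Z, X ++ A = rd T1 ++ rev v2 -> B ++ Z = rev v1 ++ rd T2 ->
     transfer c a A B /\ transfer a c A B) ->
  is_SDT n (T1 ++ (v1 ++ a :: v2) :: T2).
Proof.
move=> /is_SDTP [shT lT okT] an H; apply/is_SDTP; split.
- by move: shT; rewrite /shape !map_cat /= !size_cat.
- move: lT; rewrite !all_cat /= !all_cat /= an.
  by case/and3P=> -> /and3P[-> _ ->] ->.
move=> r /okT ok.
have [rk|rk|rk] := ltngtP r.+1 (size T1).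
- by move: ok; rewrite !nth_cat rk ltnW.
- have [rk'|{}rk'] := eqVneq r (size T1); last first.
    have lt1 : r < size T1 = false by lia.
    have lt2 : r.+1 < size T1 = false by lia.
    have [m mE] : exists m, r - size T1 = m.+1 by exists (r - size T1).-1; lia.
    have mE' : r.+1 - size T1 = m.+2 by lia.
    by move: ok; rewrite !nth_cat lt1 lt2 mE mE'.
  move: ok; rewrite !nth_cat {}rk' ltnn ltnNge leqnSn /= subnn subSnn /=.
  set u := nth [::] T2 0.
  have [X [Z [XE ZE]]] : exists X Z, X ++ rev v2 = rd T1 ++ rev v2 /\
     (rev v1 ++ rev u) ++ Z = rev v1 ++ rd T2.
    exists (rd T1), (rd (behead T2)); split => //; rewrite -catA.
    by rewrite /u; case: (T2).
  have [ca ac] := H _ _ _ _ XE ZE.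
  have [ca' _] := H _ _ _ (rev u ++ Z) XE (etrans (catA _ _ _) ZE).
  move=> /row_okP [|[vv mx]]; first by case: (v1).
  apply/row_okP; right; move: vv mx; rewrite !rev_cat !rev_cons !cat_rcons -!catA !cat_cons => vv mx.
  split; first exact: transfer_valley ca' vv.
  by move=> s /ac H' /H' [s' [sub vs <-]]; have := mx _ sub vs; rewrite !size_cat.
move: ok; rewrite !nth_cat rk ltnn subnn leqnn /=.
set v := nth [::] T1 r.
have XE : rd (take r T1) ++ (rev v ++ rev v2) = rd T1 ++ rev v2.
  rewrite catA; congr cat; rewrite -[in RHS](cat_take_drop r T1) rd_cat.
  by rewrite (drop_nth [::]) -?rk // rd_cons rk drop_size cats0.
have [ca ac] := H _ (rev v ++ rev v2) (rev v1) (rd T2) XE erefl.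
move=> /row_okP [->|[vv mx]]; first by apply/row_okP; left.
apply/row_okP; right; split=> // s.
rewrite !rev_cat !rev_cons !cat_rcons catA => /ac H' /H' [s' [sub vs <-]].
by apply: mx => //; rewrite !rev_cat !rev_cons !cat_rcons catA.
Qed.

Lemma SDT_positive n T : is_SDT n T -> positive (rd T).
Proof.
move=> /is_SDTP [_ /allP H _]; apply/allP => z /flattenP [v /mapP [w /H/allP wT ->]].
by rewrite mem_rev => /wT /andP[].
Qed.

Lemma positive_factor X A c B Z : positive ((X ++ A) ++ c :: (B ++ Z)) -> positive (A ++ B).
Proof. by rewrite /positive !all_cat /= !all_cat => /andP[/andP[_ ->] /and3P[_ -> _]]. Qed.

Lemma SDT_active n (x : qindex n) T1 v1 v2 T2 : 1 < n ->
  active x (rd T1 ++ rev v2) (rev v1 ++ rd T2) ->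
  is_SDT n (T1 ++ (v1 ++ lo x :: v2) :: T2) = is_SDT n (T1 ++ (v1 ++ hi x :: v2) :: T2).
Proof.
move=> n1 act.
have ln : 1 <= lo x <= n by case: (x) => [[i ]|] //=; rewrite /lo /=; lia.
have hn : 1 <= hi x <= n by case: (x) => [[i ]|] //=; rewrite /hi /=; lia.
apply/idP/idP => T_SDT; apply: (SDT_change T_SDT) => // X A B Z XE ZE.
  have pos : positive (A ++ B).
    by apply: (@positive_factor X _ (lo x) _ Z); rewrite XE ZE -rd_box; apply: SDT_positive T_SDT.
  have {}act : active x A B by apply: (@active_factor _ x X _ _ Z); rewrite XE ZE.
  by split=> s; [apply: valley_raise act pos|apply: valley_lower act pos].
have pos : positive (A ++ B).
  by apply: (@positive_factor X _ (hi x) _ Z); rewrite XE ZE -rd_box; apply: SDT_positive T_SDT.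
have {}act : active x A B by apply: (@active_factor _ x X _ _ Z); rewrite XE ZE.
by split=> s; [apply: valley_lower act pos|apply: valley_raise act pos].
Qed.

Lemma subseq_cat_split (s x y : seq nat) : subseq s (x ++ y) ->
  exists s1 s2 : seq nat, [/\ s = s1 ++ s2, subseq s1 x & subseq s2 y].
Proof.
move=> /subseqP [m szm ->].
exists (mask (take (size x) m) x), (mask (drop (size x) m) y).
rewrite -{1}(cat_take_drop (size x) m) mask_cat.
  by split => //; apply: mask_subseq.
by rewrite size_takel // szm size_cat leq_addr.
Qed.

Lemma valley_subseq s t : subseq t s -> valley s -> valley t.
Proof.
move=> ts [D [E [sE dD iE]]]; move: ts; rewrite sE => /subseq_cat_split [t1 [t2 [-> s1 s2]]].
exists t1, t2; split => //; [exact: subseq_pairwise s1 dD|exact: subseq_pairwise s2 iE].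
Qed.

(** Used to exhibit hook subwords that are too long. *)
Lemma valley_cat_nseq z x b : valley z -> (z = [::] \/ last 0 z <= x) ->
  valley (z ++ nseq b x).
Proof.
have pn k : pairwise leq (nseq k x).
  by apply/(pairwiseP 0) => i j; rewrite !inE size_nseq => ik jk _; rewrite !nth_nseq ik jk.
case=> D [E [-> dD iE]] H.
exists D, (E ++ nseq b x); split; rewrite ?catA //.
rewrite pairwise_cat iE pn !andbT.
case/lastP: E iE H => [|E e] // iE [|].
  by move/eqP; rewrite -size_eq0 size_cat size_rcons addnS.
rewrite last_cat last_rcons => ex.
apply/allrelP => a c aE /nseqP[-> _]; apply: leq_trans ex.
move: aE; rewrite mem_rcons in_cons => /predU1P [->//|].
by move: iE; rewrite pairwise_rcons => /andP[/allP H _] /H.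
Qed.

Lemma next_row_shorter n T r : is_SDT n T -> nth [::] T r.+1 <> [::] ->
  r.+1 < n /\ size (nth [::] T r.+1) < size (nth [::] T r).
Proof.
move=> T_SDT; have szT := SDT_size T_SDT.
have [rn|rn] := ltnP r.+1 n; last by rewrite nth_default ?szT.
move/is_SDTP: T_SDT => [/andP[_ /(sortedP 0) srt] _ _].
have := srt r; rewrite size_map szT rn => /(_ isT).
rewrite !(nth_map [::]) ?szT ?(ltnW rn) // => /andP[le /implyP eqz] ne; split=> //.
rewrite ltn_neqAle le andbT eq_sym; apply/eqP => /eqP E; apply: ne.
by apply: size0nil; rewrite -(eqP E); apply/eqP/eqz.
Qed.

(** Otherwise [x v] would be a hook subword longer than [v]. *)
Lemma next_row_lt_head u v x : row_ok u v -> v <> [::] -> x \in u -> x < head 0 v.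
Proof.
move=> ok v0 xu; rewrite ltnNge; apply/negP => le.
have : size (rev v ++ nseq 1 x) <= size v.
  apply: (row_max ok) => //; last first.
    apply: valley_cat_nseq; first exact: row_valley ok.
    by right; case: (v) le => //= a s; rewrite rev_cons last_rcons.
  by rewrite cat_subseq // sub1seq mem_rev.
by rewrite size_cat size_rev addn1 ltnn.
Qed.

Lemma SDT_letters n T r : is_SDT n T -> r < n ->
  all (fun c => 1 <= c <= n - r) (nth [::] T r).
Proof.
move=> T_SDT; have szT := SDT_size T_SDT; have /is_SDTP [_ lT okT] := T_SDT.
elim: r => [|r IH] rn.
  rewrite subn0; apply: (allP lT); apply: mem_nth; rewrite szT; lia.
have {}IH := IH (ltnW rn).
apply/allP => x xr.
have nz : nth [::] T r.+1 <> [::] by case: (nth _ _ _) xr.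
have [_ sz] := next_row_shorter T_SDT nz.
have v0 : nth [::] T r <> [::] by case: (nth [::] T r) sz.
have := next_row_lt_head (okT r (ltnW rn)) v0 xr.
have -> : 0 < x.
  have /allP/(_ x xr) /andP[] // : all (fun a => 0 < a <= n) (nth [::] T r.+1).
  by apply: (allP lT); apply: mem_nth; rewrite szT.
case: (nth [::] T r) IH v0 => //= a s /andP[/andP[_ an] _] _; lia.
Qed.

Definition run_length n T r := find (predC1 (n - r)) (nth [::] T r).
Definition core n T : tableau := mkseq (fun r => drop (run_length n T r) (nth [::] T r)) n.

Lemma run_cat_drop c (v : seq nat) : v = nseq (find (predC1 c) v) c ++ drop (find (predC1 c) v) v.
Proof.
elim: v => [|a v IH] //=; case: eqP => [->|_] //=.
by rewrite -IH.
Qed.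

Lemma drop_run_head c (v : seq nat) : drop (find (predC1 c) v) v = [::] \/
  head 0 (drop (find (predC1 c) v) v) <> c.
Proof.
elim: v => [|a v IH] //=; first by left.
by case: eqP => //= ac; right.
Qed.

(** If the letters [i] of the row of index [n - i] were more numerous, putting them
    in place of the run of [i + 1] above would give a hook subword longer than
    that row. *)
Lemma count_le_run n T i r : is_SDT n T -> 0 < i -> r.+1 + i = n ->
  count_mem i (nth [::] T r.+1) <= run_length n T r.
Proof.
move=> T_SDT i0 rE; have rn : r < n by lia.
have [nz|nz] := eqVneq (nth [::] T r.+1) [::]; first by rewrite nz.
have [_ sz] := next_row_shorter T_SDT (elimN eqP nz).
have /is_SDTP [_ lT okT] := T_SDT; have ok := okT r rn.
have bd := SDT_letters T_SDT rn.
have v0 : nth [::] T r <> [::] by case: (nth [::] T r) sz.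
rewrite /run_length; set v := nth [::] T r in ok v0 bd *; set u := nth [::] T r.+1 in ok *.
have niE : n - r = i.+1 by lia.
rewrite niE in bd *.
have vE := run_cat_drop i.+1 v; have hd := drop_run_head i.+1 v.
set a := find _ v in vE hd *; set y := drop a v in vE hd.
have /(row_max ok v0) : subseq (rev y ++ nseq (count_mem i u) i) (rev v ++ rev u).
  rewrite cat_subseq ?subseq_nseq ?count_rev // subseq_rev vE.
  exact: suffix_subseq.
have vy : valley (rev y ++ nseq (count_mem i u) i).
  apply: valley_cat_nseq.
    apply: valley_subseq (row_valley ok); rewrite subseq_rev vE.
    exact: suffix_subseq.
  case: hd => [->|hd]; [by left|].
  case: (y) hd vE => [|b y'] /= hd vE; [by left|right].
  rewrite rev_cons last_rcons.
  move: bd; rewrite vE all_cat /= => /and3P[_ /andP[_ bi] _]; lia.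
have sv : size v = a + size y by rewrite {1}vE size_cat size_nseq.
move=> /(_ vy); rewrite size_cat size_nseq size_rev sv.
by rewrite [a + _]addnC leq_add2l.
Qed.

Lemma tab_f_SDT n (x : qindex n) T T' : 1 < n -> is_SDT n T -> tab_f x T = Some T' ->
  is_SDT n T' /\ shape T' = shape T.
Proof.
move=> n1 T_SDT /tab_fP [A [B [wE act ->]]].
have [T1 [v1 [v2 [T2 [TE AE BE]]]]] := boxP wE.
rewrite TE AE changeE //; split; last by rewrite /shape !map_cat /= !size_cat.
by rewrite -SDT_active // -?TE // -AE -BE.
Qed.

Lemma tab_e_SDT n (x : qindex n) T T' : 1 < n -> is_SDT n T -> tab_e x T = Some T' ->
  is_SDT n T' /\ shape T' = shape T.
Proof.
move=> n1 T_SDT /tab_eP [A [B [wE act ->]]].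
have [T1 [v1 [v2 [T2 [TE AE BE]]]]] := boxP wE.
rewrite TE AE changeE //; split; last by rewrite /shape !map_cat /= !size_cat.
by rewrite SDT_active // -?TE // -AE -BE.
Qed.

(** * Connectedness of words *)

Definition word_step n (u v : seq nat) : Prop := exists (x : qindex n) A B,
  [/\ u = A ++ hi x :: B, v = A ++ lo x :: B & active x A B].

Inductive word_conn n : seq nat -> seq nat -> Prop :=
| word_conn_refl w : word_conn n w w
| word_conn_e u v w : word_step n u v -> word_conn n v w -> word_conn n u w
| word_conn_f u v w : word_step n v u -> word_conn n v w -> word_conn n u w.

Lemma word_conn_trans n u v w : word_conn n u v -> word_conn n v w -> word_conn n u w.
Proof.
elim=> // {}u v' w' st _ IH /IH; [exact: word_conn_e|exact: word_conn_f].
Qed.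

Lemma word_conn_sym n u v : word_conn n u v -> word_conn n v u.
Proof.
elim=> [w|{}u v' w st _ IH|{}u v' w st _ IH]; first exact: word_conn_refl.
  by apply: word_conn_trans IH _; apply: word_conn_f st (word_conn_refl _ _).
by apply: word_conn_trans IH _; apply: word_conn_e st (word_conn_refl _ _).
Qed.

Lemma word_conn_step n u v : word_step n u v -> word_conn n u v.
Proof. by move=> st; apply: word_conn_e st (word_conn_refl _ _). Qed.

Lemma word_step_even n i A B : 0 < i < n -> balanced i A B ->
  word_step n (A ++ i.+1 :: B) (A ++ i :: B).
Proof.
case: i => // i /andP[_ lt] bal.
have lt' : i < n.-1 by lia.
by exists (Even (Ordinal lt')), A, B.
Qed.

Lemma word_step_odd n A B : ~~ has (pair_letter 1) A -> word_step n (A ++ 2 :: B) (A ++ 1 :: B).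
Proof. by move=> h; exists Odd1, A, B. Qed.

Definition letters_in n (w : seq nat) := all (fun c => 1 <= c <= n) w.

(** Operators keep the length of a word and its letters in range, so that the sum
    of the letters stays bounded along a path. *)
Lemma word_conn_letters n u v : 1 < n -> word_conn n u v -> letters_in n u ->
  letters_in n v /\ size v = size u.
Proof.
move=> n1; elim=> // {}u v' w [x [A [B [uE vE _]]]] _ IH uin.
  have [|-> ->] := IH.
    move: uin; rewrite uE vE /letters_in !all_cat /= => /and3P[-> _ ->].
    by rewrite andbT /=; case: (x) => [[i ]|] /=; rewrite /lo /=; lia.
  by rewrite uE vE !size_cat.
have [|-> ->] := IH.
  move: uin; rewrite uE vE /letters_in !all_cat /= => /and3P[-> _ ->].
  by rewrite andbT /=; case: (x) => [[i ]|] /=; rewrite /hi /=; lia.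
by rewrite uE vE !size_cat.
Qed.

Lemma bracket_large i A : all (leq i.+2) A -> bracket i A = (0, 0).
Proof.
move=> /allP H; apply: bracket_no_letters; apply/hasPn => z /H /=; rewrite /pair_letter; lia.
Qed.

Lemma bracket_excess i P S : count_mem i P <= count_mem i.+1 P + (bracket i (P ++ S)).1.
Proof. by have := bracket_count i P; rewrite bracket_cat /bracket_mul /=; lia. Qed.

Lemma bracket_excess_attained i w : exists P S : seq nat,
  w = P ++ S /\ count_mem i P = count_mem i.+1 P + (bracket i w).1.
Proof.
elim: w => [|c w [P [S [wE IH]]]]; first by exists [::], [::].
have [c0|c1] := posnP (bracket i (c :: w)).1; first by exists [::], (c :: w); rewrite c0.
exists (c :: P), S; rewrite wE; split => //; rewrite -wE /=.
move: c1 IH; rewrite /= /bracket_mul /bracket1 /=.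
by case: (c =P i) => [->|ci]; rewrite ?eqS_F /=; lia.
Qed.

(** If there is an unmatched [i], then [f_i] is defined. *)
Lemma word_conn_raise n i w : 0 < i < n -> 0 < (bracket i w).1 -> exists w',
  [/\ word_conn n w w', sumn w' = (sumn w).+1 & (bracket i w').1 = (bracket i w).1.-1].
Proof.
move=> iI; have [Q [P [_ _ szs [_ H]]]] := reducedP i w.
rewrite -{1}szs; case: P szs H => [|y P] // szs H _.
have [A [B [wE _ bal]]] := H _ _ erefl.
exists (A ++ i.+1 :: B); split.
- by rewrite wE; apply/word_conn_sym/word_conn_step/word_step_even.
- by rewrite wE !sumn_cat /=; lia.
case: bal => bA bB.
rewrite wE !bracket_mid /bracket_mul /bracket1 /= !eqxx eqS_F eSq_F bB; lia.
Qed.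

Lemma word_conn_chain n (h : nat -> seq nat) k m : k <= m ->
  (forall i, k <= i < m -> word_conn n (h i.+1) (h i)) -> word_conn n (h m) (h k).
Proof.
move=> km; rewrite -(subnKC km); elim: (m - k) => [|d IH] H.
  by rewrite addn0; apply: word_conn_refl.
rewrite addnS; apply: word_conn_trans (H (k + d) _) (IH _); first lia.
by move=> i ik; apply: H; lia.
Qed.

Lemma bracket1_other i c : c != i -> c != i.+1 -> bracket1 i c = (0, 0).
Proof. by rewrite /bracket1 => /negbTE-> /negbTE->. Qed.

Lemma bracket_cons i c w : bracket i (c :: w) = bracket_mul (bracket1 i c) (bracket i w).
Proof. by []. Qed.

Lemma bracket_notin i w : i \notin w -> (bracket i w).1 = 0.
Proof.
elim: w => //= c w IH; rewrite in_cons negb_or eq_sym => /andP[/negbTE ci /IH].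
by rewrite /bracket_mul /bracket1 /= ci; lia.
Qed.

Lemma bracket_two_letters i A a M b B : bracket i (A ++ a :: M ++ b :: B) =
  bracket_mul (bracket i A) (bracket_mul (bracket1 i a)
    (bracket_mul (bracket i M) (bracket_mul (bracket1 i b) (bracket i B)))).
Proof. by rewrite bracket_cat /= bracket_cat. Qed.

(** The letters shown are the first [j + 1] and the first [j] of a word in which
    nothing smaller comes before them.  A step of the path that involves [i] and
    [i + 1] changes a letter with no [i + 1] before it and no unmatched [i] after
    it, so the bracketing rule allows it. *)
Lemma word_conn_lower_first n j A M B : 0 < j < n ->
  all (leq j.+2) A -> all (leq j.+1) M ->
  (forall i, 0 < i < j -> (bracket i B).1 = 0) ->
  (bracket j (A ++ j.+1 :: M ++ j :: B)).1 = 0 ->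
  word_conn n (A ++ j.+1 :: M ++ j :: B) (A ++ j :: M ++ j :: B).
Proof.
move=> jI hA hM hB hj.
have bA i : i <= j -> bracket i A = (0, 0).
  by move=> ij; apply: bracket_large; apply: sub_all hA => z /=; lia.
have bM i : i < j -> bracket i M = (0, 0).
  by move=> ij; apply: bracket_large; apply: sub_all hM => z /=; lia.
(* The first [j] goes down to [1]. *)
apply: (@word_conn_trans _ _ (A ++ j.+1 :: M ++ 1 :: B)).
  apply: (@word_conn_chain n (fun i => A ++ j.+1 :: M ++ i :: B) 1 j); first lia.
  move=> i ij; apply: word_conn_step; rewrite -!cat_cons !catA; apply: word_step_even; first lia.
  split; last by apply: hB; lia.
  rewrite bracket_cat /= bA ?bM; try lia.
  by move=> /=; lia.
(* The first [j + 1] goes down to [2]. *)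
apply: (@word_conn_trans _ _ (A ++ 2 :: M ++ 1 :: B)).
  apply: (@word_conn_chain n (fun i => A ++ i :: M ++ 1 :: B) 2 j.+1); first lia.
  move=> i ij; apply: word_conn_step; apply: word_step_even; first lia.
  split; first by rewrite bA //; lia.
  rewrite bracket_cat bracket_cons (@bracket1_other i 1); try lia.
  have [ltij|] := ltnP i j; first by rewrite bM // !bracket_mul0l hB //; lia.
  move=> ji; have {ij ji}-> : i = j by lia.
  have M1 : (bracket j M).1 = 0.
    by apply: bracket_notin; apply/negP => /(allP hM) /=; rewrite ltnn.
  move: hj; rewrite bracket_two_letters bA // /bracket1 !eqxx eSq_F eqS_F !bracket_mul0l /bracket_mul /=; lia.
(* The odd operator turns it into [1], and both letters go up to [j]. *)
apply: (@word_conn_trans _ _ (A ++ 1 :: M ++ 1 :: B)).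
  apply/word_conn_step/word_step_odd/hasPn => z /(allP hA) /=; rewrite /pair_letter; lia.
apply: (@word_conn_trans _ _ (A ++ 1 :: M ++ j :: B)); apply: word_conn_sym.
  apply: (@word_conn_chain n (fun i => A ++ 1 :: M ++ i :: B) 1 j); first lia.
  move=> i ij; apply: word_conn_step; rewrite -!cat_cons !catA; apply: word_step_even; first lia.
  split; last by apply: hB; lia.
  rewrite bracket_cat /= bA ?bM; try lia.
  by rewrite /bracket1 /bracket_mul /=; lia.
apply: (@word_conn_chain n (fun i => A ++ i :: M ++ j :: B) 1 j); first lia.
move=> i ij; apply: word_conn_step; apply: word_step_even; first lia.
split; first by rewrite bA //; lia.
rewrite bracket_cat bM /=; last lia.
by rewrite /bracket1 /bracket_mul /= hB; lia.
Qed.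

(** In a word without unmatched [j], the two numbers are then equal. *)
Definition violates j w := exists P S,
  [/\ w = P ++ S, 0 < count_mem j P & count_mem j.+1 P <= count_mem j P].

(** The words at which the reduction below stops. *)
Definition strict_prefixes n w := forall j, 0 < j < n -> ~ violates j w.

(** Once the first [j + 1] has been turned into [j], the prefix that violates the
    strict inequality has two unmatched [j]. *)
Lemma word_conn_progress n j w : 0 < j < n -> positive w ->
  (forall i, 0 < i < n -> (bracket i w).1 = 0) ->
  (forall i, 0 < i < j -> ~ violates i w) -> violates j w ->
  exists w', word_conn n w w' /\ sumn w' = (sumn w).+1.
Proof.
move=> jI pos low strict_below [P [S [wE cj cj1]]].
have jw : j \in w by rewrite wE mem_cat -has_pred1 has_count cj.
(* [C], the part of [w] before the first [j], has no letter [j] and no unmatched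
   smaller letter, hence no smaller letter at all. *)
have [C [B [wCB jC]]] : exists C B, w = C ++ j :: B /\ j \notin C.
  exists (take (index j w) w), (drop (index j w).+1 w).
  rewrite -{1}(cat_take_drop (index j w) w) (drop_nth 0) ?index_mem // nth_index //.
  by split => //; rewrite in_take_leq ?ltnn // index_size.
have Clow i : 0 < i <= j -> i \notin C.
  move=> ij; have [k jE] : exists k, j = i + k by exists (j - i); lia.
  elim: k i jE ij => [|k IH] i jE ij; first by have <- : j = i by lia.
  have := IH i.+1; rewrite -!has_pred1 !has_count => /(_ ltac:(lia) ltac:(lia)).
  have := bracket_excess i C (j :: B); rewrite -wCB low; lia.
have Cpos : positive C by move: pos; rewrite wCB /positive all_cat => /andP[].
have jSC : j.+1 \in C.
  have := bracket_excess j (rcons C j) B; rewrite cat_rcons -wCB low //.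
  rewrite -cats1 !count_cat /= eqxx eqS_F -has_pred1 has_count /=; lia.
have [A [M [CE jSA]]] : exists A M, C = A ++ j.+1 :: M /\ j.+1 \notin A.
  exists (take (index j.+1 C) C), (drop (index j.+1 C).+1 C).
  rewrite -{1}(cat_take_drop (index j.+1 C) C) (drop_nth 0) ?index_mem // nth_index //.
  by split => //; rewrite in_take_leq ?ltnn // index_size.
have Clt : all (leq j.+1) C.
  apply/allP => z zC; rewrite /= ltnNge; apply/negP => zj.
  by have := Clow z; rewrite zC => /(_ _)/negP; apply; rewrite ?(allP Cpos _ zC) ?zj.
have hM : all (leq j.+1) M by move: Clt; rewrite CE all_cat => /and3P[].
have hA : all (leq j.+2) A.
  apply/allP => z zA; have : z != j.+1 by apply: contraNneq jSA => <-.
  have := allP Clt z; rewrite CE mem_cat zA => /(_ isT) /=; lia.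
have wE' : w = A ++ j.+1 :: M ++ j :: B by rewrite wCB CE -catA.
have hB i : 0 < i < j -> (bracket i B).1 = 0.
  move=> ij; have bC : bracket i C = (0, 0).
    by apply: bracket_large; apply: sub_all Clt => z /=; lia.
  have := low i; rewrite wCB bracket_cat bC bracket_mul0l bracket_cons => /(_ ltac:(lia)).
  have [jE|ji] := eqVneq j i.+1; last first.
    by rewrite bracket1_other ?bracket_mul0l //; lia.
  have [P' [S' [BE ex]]] := bracket_excess_attained i B.
  rewrite /bracket1 jE eqxx eSq_F /bracket_mul /= => b1.
  have [//|b1'] := posnP (bracket i B).1.
  case: (strict_below i) => //; exists (C ++ j :: P'), S'.
  have Ci : count_mem i C = 0 by apply/count_memPn/Clow; lia.
  have CiS : count_mem i.+1 C = 0 by apply/count_memPn/Clow; lia.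
  split; first by rewrite wCB BE -catA.
    by rewrite !count_cat /= Ci jE eSq_F /=; rewrite !add0n ex; lia.
  by rewrite !count_cat /= Ci CiS jE eSq_F eqxx /= !add0n ex addnC; apply: leq_add.
have conn : word_conn n w (A ++ j :: M ++ j :: B).
  by rewrite wE'; apply: word_conn_lower_first => //; rewrite -wE' low.
(* In the violating prefix there are now at least two more [j] than [j + 1]. *)
have ex2 : 1 < (bracket j (A ++ j :: M ++ j :: B)).1.
  have [P' [PE BE]] : exists P', P = A ++ j.+1 :: M ++ j :: P' /\ B = P' ++ S.
    have sz : size C < size P.
      rewrite ltnNge; apply/negP => le.
      have : P = take (size P) C.
        move/eqP: wCB; rewrite wE -{1}(cat_take_drop (size P) C) -catA.
        by rewrite eqseq_cat ?size_takel // => /andP[/eqP].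
      move=> PE; have : j \in P by rewrite -has_pred1 has_count.
      by rewrite PE => /mem_take; apply/negP.
    have wPS : C ++ j :: B = P ++ S by rewrite -wCB.
    exists (drop (size C).+1 P).
    move/eqP: wPS; rewrite -{1}(cat_take_drop (size C) P) -catA eqseq_cat ?size_takel ?(ltnW sz) //.
    rewrite (drop_nth 0) //= => /andP[/eqP CP /eqP [jP BP]]; split => //.
    transitivity (C ++ j :: drop (size C).+1 P); last by rewrite CE -catA.
    by rewrite -[LHS](cat_take_drop (size C)) (drop_nth 0) //; congr (_ ++ _ :: _).
  have := bracket_excess j (A ++ j :: M ++ j :: P') S.
  rewrite -!catA /= -catA /= -BE.
  move: cj1; rewrite PE !count_cat /= !count_cat /= eqxx eSq_F eqS_F eqxx.
  lia.
have [w1 [c1 s1 e1]] := word_conn_raise jI (ltnW ex2).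
have [|w2 [c2 s2 e2]] := @word_conn_raise n j w1 jI; first by rewrite e1; lia.
exists w2; split; first exact: word_conn_trans conn (word_conn_trans c1 c2).
by rewrite s2 s1 wE' !sumn_cat /= !sumn_cat /=; lia.
Qed.

Lemma sumn_letters n w : letters_in n w -> sumn w <= n * size w.
Proof. by elim: w => [|c w IH] //= /andP[cn /IH]; rewrite mulnS; lia. Qed.

Lemma word_conn_strict n w : 1 < n -> letters_in n w -> exists w', word_conn n w w' /\ strict_prefixes n w'.
Proof.
move=> n1; have [d] := ubnP (n * size w - sumn w); elim: d w => // d IH w le win.
have ind w' : word_conn n w w' -> sumn w' = (sumn w).+1 ->
    exists w', word_conn n w w' /\ strict_prefixes n w'.
  move=> c s; have [win' szw'] := word_conn_letters n1 c win.
  have [||w2 [c2 st]] := IH w' => //.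
    by have := sumn_letters win'; rewrite szw' s; lia.
  by exists w2; split => //; apply: word_conn_trans c c2.
have [[i [iI hi]]|low] := pselect (exists i, 0 < i < n /\ 0 < (bracket i w).1).
  by have [w' [c s _]] := word_conn_raise iI hi; apply: ind c s.
have {}low i : 0 < i < n -> (bracket i w).1 = 0.
  by move=> iI; have [//|h] := posnP (bracket i w).1; case: low; exists i.
have pos : positive w by apply: sub_all win => z /andP[].
have [[w' [c s]]|none] := pselect (exists w', word_conn n w w' /\ sumn w' = (sumn w).+1).
  exact: ind c s.
exists w; split; first exact: word_conn_refl.
move=> j; have [m] := ubnP j; elim: m j => // m IHm j jm jI viol; apply: none.
apply: (word_conn_progress jI pos low _ viol) => i ij; apply: IHm; lia.
Qed.

(** After rows made of larger letters only, strictness allows no first letter but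
    [z], and then no second letter but [z]; and a valley word that starts with
    [z z] is weakly increasing. *)
Lemma strict_row_constant n z P x S : 0 < z <= n -> strict_prefixes n (P ++ x ++ S) ->
  all (leq z.+1) P -> all (fun c => 1 <= c <= z) x -> valley x -> x = nseq (size x) z.
Proof.
move=> zn st Pz xz vx.
have noP c : c <= z -> count_mem c P = 0.
  by move=> cz; apply/count_memPn/negP => /(allP Pz) /=; lia.
have top c x1 x2 : x = x1 ++ c :: x2 -> count_mem c.+1 (rcons x1 c) <= 1 -> c = z.
  move=> xE le1; have cz : 0 < c <= z by apply: (allP xz); rewrite xE mem_cat mem_head orbT.
  have [//|neq] := eqVneq c z; case: (st c); first lia.
  exists (P ++ rcons x1 c), (x2 ++ S); split.
  - by rewrite xE -!catA cat_rcons.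
  - by rewrite -cats1 !count_cat /= eqxx; lia.
  - rewrite !count_cat !noP ?add0n; try lia.
    by apply: leq_trans le1 _; rewrite -has_count has_pred1 mem_rcons mem_head.
apply/all_pred1P.
case: x vx xz top {st} => [|b [|c x]] vx xz top //=.
  by rewrite (top b [::] [::]) ?eqxx //= eqS_F.
have bz : b = z by apply: (top b [::] (c :: x)) => //=; rewrite eqS_F.
have cz : c = z.
  by apply: (top c [:: b] x) => //=; rewrite eqS_F; case: eqP.
rewrite bz cz !eqxx /=; rewrite bz cz in vx.
move: xz; rewrite /= => /and3P[_ _ /allP xz].
case: vx => -[|d [|d' D]] [E [/= sE dD iE]].
- move: iE; rewrite -sE /= => /and3P[_ /allP H _].
  by apply/allP => a ax; have := xz a ax; have := H a ax => /=; lia.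
- case: sE iE => _ <- /= /andP[/allP H _].
  by apply/allP => a ax; have := xz a ax; have := H a ax => /=; lia.
- by case: sE dD => <- <- _ /=; rewrite ltnn.
Qed.

Lemma SDT_strict_prefixes n T : is_SDT n T -> strict_prefixes n (rd T) -> T = Ltab n (shape T).
Proof.
move=> T_SDT st; have szT := SDT_size T_SDT.
suff rowE r : r < n -> nth [::] T r = nseq (size (nth [::] T r)) (n - r).
  apply: (@eq_from_nth _ [::]); first by rewrite size_mkseq.
  by move=> r; rewrite szT => rn; rewrite nth_mkseq // (nth_map [::]) ?szT // {1}rowE.
have [m] := ubnP r; elim: m r => // m IH r rm rn.
have /is_SDTP [_ _ /(_ r rn) /row_valley vr] := T_SDT.
have bd := SDT_letters T_SDT rn.
set v := nth [::] T r in vr bd *.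
have rdE : rd T = rd (take r T) ++ rev v ++ rd (drop r.+1 T).
  by rewrite -[in LHS](cat_take_drop r T) rd_cat (drop_nth [::]) ?szT.
suff : rev v = nseq (size (rev v)) (n - r).
  by move/(congr1 rev); rewrite revK size_rev rev_nseq.
apply: (@strict_row_constant n _ (rd (take r T)) _ (rd (drop r.+1 T))) => //.
- lia.
- by rewrite -rdE.
- apply/allP => z /flattenP [w /mapP [u /(nthP [::]) [t]]].
  rewrite size_takel ?szT ?(ltnW rn) // => tr <- ->.
  by rewrite nth_take // mem_rev IH; [move=> /nseqP[-> _] /=; lia|lia|lia].
- by rewrite all_rev.
Qed.

(** * Cores and their fillings *)

(** The rows of [K] are those of index [r], [r + 1], and so on in the whole
    tableau, which explains the letters of the runs that are put before them. *)
Fixpoint fill_rows n (rho : nat -> nat) r (K : tableau) : tableau :=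
  if K is k :: K' then (nseq (rho r) (n - r) ++ k) :: fill_rows n rho r.+1 K' else [::].
Notation fill n rho K := (fill_rows n rho 0 K).

Lemma size_fill_rows n rho r K : size (fill_rows n rho r K) = size K.
Proof. by elim: K r => //= k K IH r; rewrite IH. Qed.

Lemma fill_rows_cat n rho r K1 K2 :
  fill_rows n rho r (K1 ++ K2) = fill_rows n rho r K1 ++ fill_rows n rho (r + size K1) K2.
Proof. by elim: K1 r => [|k K1 IH] r /=; rewrite ?addn0 // IH addSnnS. Qed.

Lemma nth_fill_rows n rho r K t : t < size K ->
  nth [::] (fill_rows n rho r K) t = nseq (rho (r + t)) (n - (r + t)) ++ nth [::] K t.
Proof.
elim: K r t => //= k K IH r [|t] tK /=; first by rewrite addn0.
by rewrite IH // addSnnS.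
Qed.

Lemma eq_fill_rows n rho rho' r K : (forall t, r <= t < r + size K -> rho t = rho' t) ->
  fill_rows n rho r K = fill_rows n rho' r K.
Proof.
elim: K r => //= k K IH r H; rewrite H; last lia.
by congr cons; apply: IH => t tr; apply: H; lia.
Qed.

(** What remains of the rows of a decomposition tableau when the initial runs are
    removed.  The last condition makes a core recoverable from its fillings. *)
Definition is_core n (K : tableau) : Prop := size K = n /\ forall r, r < n ->
  [/\ all (fun c => 1 <= c <= n - r) (nth [::] K r), valley (rev (nth [::] K r)) &
      nth [::] K r = [::] \/ head 0 (nth [::] K r) <> n - r].

Lemma find_run a c (k : seq nat) : k = [::] \/ head 0 k <> c ->
  find (predC1 c) (nseq a c ++ k) = a.
Proof.
move=> H; elim: a => [|a IH] /=; last by rewrite eqxx /= IH.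
case: k H => [|b k] //= [//|bc].
by move/eqP: bc => /= ->.
Qed.

Lemma run_fill n rho K r : is_core n K -> r < n -> run_length n (fill n rho K) r = rho r.
Proof.
move=> [szK H] rn; rewrite /run_length nth_fill_rows ?szK // add0n find_run //.
by have [] := H r rn.
Qed.

Lemma core_fill n rho K : is_core n K -> core n (fill n rho K) = K.
Proof.
move=> KK; apply: (@eq_from_nth _ [::]); first by rewrite size_mkseq (proj1 KK).
move=> r; rewrite size_mkseq => rn; rewrite nth_mkseq // run_fill //.
by rewrite nth_fill_rows ?(proj1 KK) // add0n drop_size_cat ?size_nseq.
Qed.

Lemma fill_core n T : size T = n -> fill n (run_length n T) (core n T) = T.
Proof.
move=> szT; have szc : size (core n T) = n by rewrite size_mkseq.
apply: (@eq_from_nth _ [::]); first by rewrite size_fill_rows szc szT.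
move=> r; rewrite size_fill_rows szc => rn.
by rewrite nth_fill_rows ?szc // add0n nth_mkseq // [RHS](run_cat_drop (n - r)).
Qed.

Lemma is_core_of_SDT n rho K : is_SDT n (fill n rho K) ->
  (forall r, r < n -> nth [::] K r = [::] \/ head 0 (nth [::] K r) <> n - r) ->
  is_core n K.
Proof.
move=> T_SDT H; have szK : size K = n by have := SDT_size T_SDT; rewrite size_fill_rows.
split=> // r rn; split; last exact: H.
  by have := SDT_letters T_SDT rn; rewrite nth_fill_rows ?szK // all_cat => /andP[].
have /is_SDTP [_ _ /(_ r rn) /row_valley] := T_SDT.
apply: valley_subseq; rewrite subseq_rev [X in subseq _ X]nth_fill_rows ?szK //.
exact: suffix_subseq.
Qed.

Lemma core_is_core n T : is_SDT n T -> is_core n (core n T).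
Proof.
move=> T_SDT; have szT := SDT_size T_SDT.
apply: (@is_core_of_SDT n (run_length n T)); first by rewrite fill_core.
by move=> r rn; rewrite nth_mkseq //; apply: drop_run_head.
Qed.

(** Solution of the recursion from the bottom row, which requires every run to
    exceed by one the size of the next row. *)
Definition marginal_run (K : tableau) r := (sumn [seq (size k).+1 | k <- drop r.+1 K]).+1.

Lemma marginal_run_row n K r : size K = n -> r < n ->
  marginal_run K r = (size (nth [::] (fill n (marginal_run K) K) r.+1)).+1.
Proof.
move=> szK rn; have [lt|le] := ltnP r.+1 n; last first.
  by rewrite nth_default ?size_fill_rows ?szK // /marginal_run drop_oversize ?szK.
rewrite nth_fill_rows ?szK // add0n size_cat size_nseq.
by rewrite {1}/marginal_run (drop_nth [::]) ?szK //= /marginal_run; lia.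
Qed.

(** Before a descent, a valley word decreases strictly. *)
Lemma valley_descent x z t y : valley (x ++ z :: t) -> y \in t -> y < z ->
  all (ltn z) x.
Proof.
case=> D [E [/esym/cat_cons_eq [[D2 -> _]|[E1 -> _]] dD iE]] yt yz.
  move: dD; rewrite pairwise_cat allrel_consr => /and3P[/andP[/allP H _] _ _].
  by apply/allP => a /H.
move: iE; rewrite pairwise_cat => /and3P[_ _ /= /andP[/allP/(_ _ yt) /= zy _]].
by rewrite ltnNge zy in yz.
Qed.

(** A row that starts with a run of a large letter longer than the row below needs
    no further condition: a subword that uses both rows either avoids the run,
    or takes one letter from it and none from the rest of its row. *)
Lemma long_run_row_ok (u k : seq nat) z a : all (gtn z) u -> all (geq z) k ->
  valley (rev k) -> size u < a -> row_ok u (nseq a z ++ k).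
Proof.
move=> bu lr vr ua; apply/row_okP; right; rewrite rev_cat rev_nseq; split.
  apply: valley_cat_nseq => //; case: (k) lr => [|b k'] /=; [by left|right].
  by rewrite rev_cons last_rcons; case/andP: lr.
move=> s; rewrite -catA => /subseq_cat_split [s1 [s' [-> sub1]]].
move=> /subseq_cat_split [s2 [s3 [-> sub2 sub3]]] vs.
have le1 : size s1 <= size k by rewrite -(size_rev k); apply: size_subseq.
have le2 : size s2 <= a by rewrite -(size_nseq a z); apply: size_subseq.
have le3 : size s3 <= size u by rewrite -(size_rev u); apply: size_subseq.
rewrite !size_cat size_nseq.
case: s3 sub3 vs le3 => [|y s3] sub3 vs /= le3; first lia.
case: s2 sub2 vs le2 => [|z' s2] sub2 vs /= le2; first lia.
(* A letter of [u] comes after a letter [z] of the run: the letters of [s] up to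
   this [z] decrease strictly, hence this [z] is the only one outside [u]. *)
have zE : z' = z by have /nseqP[] : z' \in nseq a z by rewrite (mem_subseq sub2) ?mem_head.
have yz : y < z by apply: (allP bu); rewrite -mem_rev (mem_subseq sub3) ?mem_head.
rewrite {}zE in vs sub2.
have s1E : s1 = [::].
  have : all (ltn z) s1.
    by apply: (valley_descent vs _ yz); rewrite mem_cat mem_head orbT.
  case: s1 sub1 {vs le1} => //= b s1 /mem_subseq sub1 /andP[zb _].
  have := sub1 _ (mem_head _ _); rewrite mem_rev => /(allP lr) /=; lia.
have s2E : s2 = [::].
  case: s2 vs {sub2 le2} (sub2) => // z2 s2 vs sub2.
  have z2E : z2 = z.
    have /nseqP[//] : z2 \in nseq a z.
    by rewrite (mem_subseq sub2) // !in_cons eqxx orbT.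
  have : all (ltn z2) [:: z].
    apply: (@valley_descent _ _ (s2 ++ y :: s3) y).
    - by move: vs; rewrite s1E.
    - by rewrite mem_cat mem_head orbT.
    - by rewrite z2E.
  by rewrite z2E /= ltnn.
by rewrite s1E s2E /=; lia.
Qed.

Lemma fill_marginal_row_ok n K r : is_core n K -> r < n ->
  row_ok (nth [::] (fill n (marginal_run K) K) r.+1) (nth [::] (fill n (marginal_run K) K) r).
Proof.
move=> KK rn; have [szK H] := KK; have [lr vr hr] := H _ rn.
rewrite [X in row_ok _ X]nth_fill_rows ?szK // add0n; apply: long_run_row_ok => //.
- have [lt|le] := ltnP r.+1 n; last by rewrite nth_default ?size_fill_rows ?szK.
  rewrite nth_fill_rows ?szK // add0n all_cat; have [/allP lr' _ _] := H _ lt.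
  apply/andP; split; apply/allP => z; first by move=> /nseqP[-> _] /=; lia.
  by move=> /lr' /=; lia.
- by apply: sub_all lr => c /andP[].
- by rewrite (marginal_run_row szK rn).
Qed.

Lemma fill_marginal_SDTinf n K : is_core n K -> is_SDTinf n (fill n (marginal_run K) K).
Proof.
move=> KK; have [szK H] := KK; have szT : size (fill n (marginal_run K) K) = n by rewrite size_fill_rows.
have szrow r : r < n ->
    size (nth [::] (fill n (marginal_run K) K) r) = marginal_run K r + size (nth [::] K r).
  by move=> rn; rewrite nth_fill_rows ?szK // size_cat size_nseq.
apply/and3P; split; first apply/is_SDTP; first split.
- rewrite /LambdaMinus size_map szT eqxx /=; apply/(sortedP 0) => r.
  rewrite size_map szT => rn; rewrite !(nth_map [::]) ?szT ?(ltnW rn) //.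
  by have := marginal_run_row szK (ltnW rn); rewrite [X in _ <= X]szrow ?(ltnW rn) //; 
     rewrite [X in X == _]szrow ?(ltnW rn) //; lia.
- apply/allP => v /(nthP [::]) [r]; rewrite szT => rn <-.
  rewrite nth_fill_rows ?szK // add0n all_cat; have [/allP lr _ _] := H _ rn.
  by apply/andP; split; apply/allP => z; [move=> /nseqP[-> _]|move=> /lr]; lia.
- by move=> r rn; apply: fill_marginal_row_ok.
- apply/negP => /(nthP [::]) [r]; rewrite szT => rn /(congr1 size).
  by rewrite szrow.
- apply/allP => i; rewrite mem_iota => iI; apply/eqP.
  have rn : n - i < n by lia.
  by have := run_fill (marginal_run K) KK rn; rewrite /run_length subKn;
     [move=> ->; apply: marginal_run_row|lia].
Qed.

(** The lengths of the runs are forced from the bottom row upwards. *)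
Lemma SDTinf_run n K rho r : is_core n K -> is_SDTinf n (fill n rho K) -> r < n ->
  rho r = marginal_run K r.
Proof.
move=> KK /and3P[_ _ /allP H]; have [szK _] := KK.
have {}H t : t < n -> rho t = (size (nth [::] (fill n rho K) t.+1)).+1.
  move=> tn; rewrite -(run_fill rho KK tn) /run_length.
  have := H (n - t); rewrite mem_iota subKn ?(ltnW tn) // => /(_ _)/eqP; apply; lia.
have [m] := ubnP (n - r); elim: m r => // m IH r rm rn.
rewrite (marginal_run_row szK rn) H //; congr S.
have [lt|le] := ltnP r.+1 n; last by rewrite !nth_default ?size_fill_rows ?szK.
by rewrite !nth_fill_rows ?szK // !size_cat !size_nseq !add0n IH //; lia.
Qed.

Definition marginal n T : tableau := fill n (marginal_run (core n T)) (core n T).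

Lemma marginal_SDTinf n T : is_SDT n T -> is_SDTinf n (marginal n T).
Proof. by move=> /core_is_core; apply: fill_marginal_SDTinf. Qed.

Lemma SDTinf_SDT n T : is_SDTinf n T -> is_SDT n T.
Proof. by case/and3P. Qed.

(** * The operators on fillings of a core *)

Lemma count_rd_drop n T i r : is_SDT n T -> 0 < i -> r + i = n ->
  i.+1 \notin rd (drop r T) /\ count_mem i (rd (drop r T)) = count_mem i (nth [::] T r).
Proof.
move=> T_SDT i0 rE; have szT := SDT_size T_SDT.
have low t : t < n -> all (fun c => c <= n - t) (nth [::] T t).
  by move=> tn; apply: sub_all (SDT_letters T_SDT tn) => c /andP[].
have mem_drop m c : c \in rd (drop m T) -> c <= n - m.
  move=> /flattenP [w /mapP [u /(nthP [::]) [t]]].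
  rewrite size_drop szT nth_drop => tr <- ->; rewrite mem_rev => cT.
  have /allP/(_ _ cT) := low (m + t) ltac:(lia); lia.
split; first by apply/negP => /mem_drop; lia.
rewrite (drop_nth [::]) ?szT; last lia.
rewrite rd_cons count_cat count_rev; rewrite [X in _ + X](_ : _ = 0) ?addn0 //.
by apply/count_memPn/negP => /mem_drop; lia.
Qed.

(** The run of [i + 1] is long enough to match all the later [i], which are in the
    next row. *)
Lemma bracket_run_rd n T i r a : is_SDT n T -> 0 < i -> r.+1 + i = n ->
  count_mem i (nth [::] T r.+1) <= a ->
  (bracket i (nseq a i.+1 ++ rd (drop r.+1 T))).1 = 0.
Proof.
move=> T_SDT i0 rE; have [nS <-] := count_rd_drop T_SDT i0 rE => le.
by apply/eqP; rewrite bracket_cat bracket_nseqS (bracket_notinS nS) /bracket_mul /= add0n subn_eq0.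
Qed.

Lemma drop_fill_rows n rho r K m : drop m (fill_rows n rho r K) = fill_rows n rho (r + m) (drop m K).
Proof.
elim: K r m => [|k K IH] r [|m] //=; first by rewrite addn0.
by rewrite IH addSnnS.
Qed.

Lemma bracket_nseq_large i a z : i.+1 < z -> bracket i (nseq a z) = (0, 0).
Proof. by move=> zi; apply: bracket_large; apply/allP => c /nseqP[->]. Qed.

(** From the run of the row of index [r] on, the number of unmatched [i] depends on
    the core only: the runs of letters larger than [i + 1] are invisible, and the
    remaining ones form a factor without unmatched [i], by [bracket_run_rd]. *)
Lemma bracket_tail_indep n rho rho' K i r : is_core n K ->
  is_SDT n (fill n rho K) -> is_SDT n (fill n rho' K) -> 0 < i -> r + i < n ->
  (bracket i (nseq (rho r) (n - r) ++ rd (fill_rows n rho r.+1 (drop r.+1 K)))).1 =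
  (bracket i (nseq (rho' r) (n - r) ++ rd (fill_rows n rho' r.+1 (drop r.+1 K)))).1.
Proof.
move=> KK S1 S2 i0; have szK := proj1 KK.
have base rh t : is_SDT n (fill n rh K) -> t.+1 + i = n ->
    (bracket i (nseq (rh t) (n - t) ++ rd (fill_rows n rh t.+1 (drop t.+1 K)))).1 = 0.
  move=> S tE; have -> : n - t = i.+1 by lia.
  have := @bracket_run_rd n _ i t (rh t) S i0 tE; rewrite drop_fill_rows; apply.
  have := count_le_run S i0 tE.
  by rewrite (run_fill rh KK) //; lia.
have [m] := ubnP (n - r); elim: m r => // m IH r rm ri.
have [rE|rE] := eqVneq (r.+1 + i) n; first by rewrite !base.
have lt : r.+1 < size K by lia.
have nr : i.+1 < n - r by lia.
rewrite !bracket_cat !bracket_nseq_large // !bracket_mul0l.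
rewrite (drop_nth [::] lt) /= !rd_cons !rev_cat !rev_nseq -!catA.
have := IH r.+1 ltac:(lia) ltac:(lia).
by rewrite !bracket_cat /bracket_mul /= => ->.
Qed.

Lemma filter_rd_fill_rows n rho i r K : r + size K + i < n ->
  filter (pair_letter i) (rd (fill_rows n rho r K)) = filter (pair_letter i) (rd K).
Proof.
elim: K r => //= k K IH r rK.
rewrite !rd_cons !filter_cat IH; last lia.
rewrite rev_cat rev_nseq filter_cat; congr cat.
rewrite (_ : [seq x <- nseq _ _ | _] = [::]) ?cats0 //.
apply/eqP; rewrite -[_ == _]negbK -has_filter; apply/hasPn => c /nseqP[-> _].
by rewrite /pair_letter; lia.
Qed.

Lemma active_fill n (x : qindex n) K1 k1 c k2 K2 rho rho' :
  let K := K1 ++ (k1 ++ c :: k2) :: K2 in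
  let r := size K1 in
  is_core n K -> is_SDT n (fill n rho K) -> is_SDT n (fill n rho' K) -> r + lo x < n ->
  active x (rd (fill n rho K1) ++ rev k2)
    (rev (nseq (rho r) (n - r) ++ k1) ++ rd (fill_rows n rho r.+1 K2)) ->
  active x (rd (fill n rho' K1) ++ rev k2)
    (rev (nseq (rho' r) (n - r) ++ k1) ++ rd (fill_rows n rho' r.+1 K2)).
Proof.
move=> K r KK S1 S2 rx.
have K2E : K2 = drop r.+1 K.
  by rewrite /K /r -cat_rcons drop_size_cat // size_rcons.
have filt rh : filter (pair_letter (lo x)) (rd (fill n rh K1) ++ rev k2) =
    filter (pair_letter (lo x)) (rd K1 ++ rev k2).
  by rewrite !filter_cat filter_rd_fill_rows //; rewrite -/r; lia.
case: x rx filt => [i|] rx filt /=; rewrite /lo /= in rx filt.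
  rewrite /balanced -(bracket_filter _ (_ ++ rev k2)) filt => -[a1 b1]; split.
    by rewrite -(bracket_filter _ (rd (fill n rho' K1) ++ rev k2)) filt.
  move: b1; rewrite !rev_cat !rev_nseq -!catA K2E.
  have := bracket_tail_indep KK S1 S2 (ltn0Sn i) rx.
  by rewrite !bracket_cat /bracket_mul /= => ->.
by rewrite !has_filter !filt.
Qed.

Lemma cat_nseq_split (v1 v2 k : seq nat) c a z : v1 ++ c :: v2 = nseq a z ++ k ->
  (exists2 k1, v1 = nseq a z ++ k1 & k = k1 ++ c :: v2) \/
  (exists b, [/\ a = size v1 + b.+1, c = z, v1 = nseq (size v1) z & v2 = nseq b z ++ k]).
Proof.
elim: a v1 => [|a IH] [|d v1] /=.
- by move=> <-; left; exists [::].
- by move=> <-; left; exists (d :: v1).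
- by move=> [-> ->]; right; exists a.
- move=> [-> /IH [[k1 -> ->]|[b [-> -> v1E ->]]]]; first by left; exists k1.
  by right; exists b; rewrite -v1E.
Qed.

(** The operators [f] never act on the row of index [n - i]: its letters [i] are
    matched with the run of [i + 1] above. *)
Lemma f_box_above n (x : qindex n) T1 v1 v2 T2 : 1 < n ->
  let T := T1 ++ (v1 ++ lo x :: v2) :: T2 in
  is_SDT n T -> active x (rd T1 ++ rev v2) (rev v1 ++ rd T2) -> size T1 + lo x < n.
Proof.
move=> n1 T T_SDT act; have szT := SDT_size T_SDT.
have rn : size T1 < n by rewrite -szT /T size_cat /=; lia.
have rowE : nth [::] T (size T1) = v1 ++ lo x :: v2 by rewrite nth_cat ltnn subnn.
have le : lo x <= n - size T1.
  have /allP/(_ (lo x)) := SDT_letters T_SDT rn.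
  by rewrite rowE mem_cat mem_head orbT => /(_ isT) /andP[].
have lon : 0 < lo x < n by case: (x) => [[i ]|] //=; rewrite /lo /=; lia.
have [rE|] := eqVneq (size T1 + lo x) n; last lia.
case: (lastP T1) rE @T szT T_SDT rn rowE le act => [|T0 v] rE T szT T_SDT rn rowE le act.
  by move: rE => /=; lia.
rewrite size_rcons in rE rn rowE.
have vE : nth [::] T (size T0) = v.
  by rewrite /T nth_cat size_rcons ltnSn nth_rcons ltnn eqxx.
have rd1 : rd [:: v] = rev v by rewrite rd_cons cats0.
case: x @T act le lon rE szT T_SDT rn rowE vE => [i|] T act le lon rE szT T_SDT rn rowE vE;
  rewrite /lo /= in le lon rE szT T_SDT rn rowE act.
  have := count_le_run T_SDT (ltn0Sn i) rE; rewrite rowE count_cat /= eqxx => le_run.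
  case: act; rewrite -cats1 rd_cat -catA => + _.
  rewrite rd1 -vE (run_cat_drop (n - size T0) (nth [::] T (size T0))).
  rewrite -/(run_length n T (size T0)) rev_cat rev_nseq -catA catA => /bracket_suffix_count.
  rewrite !count_cat !count_nseq count_rev /= (_ : n - size T0 = i.+2); last lia.
  rewrite eqxx eSq_F mul1n mul0n add0n count_rev; lia.
have nz : nth [::] T (size T0).+1 <> [::] by rewrite rowE; case: (v1).
have [_ sz] := next_row_shorter T_SDT nz.
have bd := SDT_letters T_SDT (ltnW rn).
move: act; rewrite -cats1 rd_cat rd1 !has_cat !has_rev -orbA => /norP[_ /norP[]].
rewrite -{1}vE; case: (nth [::] T (size T0)) sz bd => [|c w] //= _ /andP[c2 _].
by rewrite /pair_letter; lia.
Qed.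

Lemma rows_split n rho K T1 v T2 : size K = n -> fill n rho K = T1 ++ v :: T2 ->
  exists K1 k K2, [/\ K = K1 ++ k :: K2, size K1 = size T1, T1 = fill n rho K1,
    v = nseq (rho (size K1)) (n - size K1) ++ k & T2 = fill_rows n rho (size K1).+1 K2].
Proof.
move=> szK E; have lt : size T1 < size K.
  by rewrite -(size_fill_rows n rho 0 K) E size_cat /=; lia.
have szt : size (take (size T1) K) = size T1 by rewrite size_takel // ltnW.
exists (take (size T1) K), (nth [::] K (size T1)), (drop (size T1).+1 K).
rewrite szt -(drop_nth [::]) // cat_take_drop.
move: E; rewrite -{1}(cat_take_drop (size T1) K) fill_rows_cat szt add0n.
rewrite (drop_nth [::]) //= => /eqP; rewrite eqseq_cat ?size_fill_rows //.
by move=> /andP[/eqP -> /eqP [<- <-]].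
Qed.

(** The operators [f] act on a box of the core, which is the same for all the
    fillings.  The letter after this box is recorded: if the box is the first one
    of its row in the core and joins the run, then the run grows by one box
    exactly. *)
Lemma tab_f_fill n (x : qindex n) K rho T' : 1 < n -> is_core n K -> is_SDT n (fill n rho K) ->
  tab_f x (fill n rho K) = Some T' ->
  exists K1 k1 k2 K2, [/\ K = K1 ++ (k1 ++ lo x :: k2) :: K2, size K1 + lo x < n,
    ohead k2 <> Some (hi x) &
    forall rho', is_SDT n (fill n rho' K) ->
      tab_f x (fill n rho' K) = Some (fill n rho' (K1 ++ (k1 ++ hi x :: k2) :: K2))].
Proof.
move=> n1 KK S1 /tab_fP [A [B [wE act _]]].
have [T1 [v1 [v2 [T2 [TE AE BE]]]]] := boxP wE.
rewrite {}AE {}BE in act wE; clear wE.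
have rx : size T1 + lo x < n by apply: f_box_above n1 _ act; rewrite -TE.
have [K1 [k [K2 [KE sz1 T1E vE T2E]]]] := rows_split (proj1 KK) TE.
rewrite -sz1 in rx.
case: (cat_nseq_split vE) => [[k1 v1E kE]|[b [_ loE _ _]]]; last by lia.
rewrite {}T1E {}T2E {}v1E in act.
exists K1, k1, v2, K2; rewrite -kE; split => //.
  case: (v2) act => [|c w] // act [cE]; rewrite {}cE in act.
  case: x act {rx TE vE kE KE} => [i|] /=; last first.
    by rewrite has_cat has_rev /= orbT.
  by move=> [+ _]; rewrite rev_cons -cats1 catA => /bracket_suffix_count; rewrite /= eqxx eSq_F.
move=> rho' S2; apply/tab_fP; rewrite KE.
exists (rd (fill n rho' K1) ++ rev v2),
  (rev (nseq (rho' (size K1)) (n - size K1) ++ k1) ++ rd (fill_rows n rho' (size K1).+1 K2)).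
split.
- by rewrite fill_rows_cat add0n [fill_rows _ _ _ (_ :: _)]/= kE (catA (nseq _ _)) rd_box.
- by move: act; apply: (@active_fill _ _ K1 k1 (lo x) v2 K2 rho); rewrite -?kE -?KE.
- by rewrite !fill_rows_cat add0n [fill_rows _ _ _ (k :: _)]/=
       [fill_rows _ _ _ (_ :: _)]/= kE !(catA (nseq _ _)) changeE.
Qed.

Lemma nseq_rcons (a z : nat) : nseq a.+1 z = rcons (nseq a z) z.
Proof. by elim: a => //= a <-. Qed.

Definition shorten_run (rho : nat -> nat) r t := if t == r then (rho t).-1 else rho t.

Lemma fill_rows_shorten_run n rho r s K : r < s -> fill_rows n (shorten_run rho r) s K = fill_rows n rho s K.
Proof. by move=> rs; apply: eq_fill_rows => t ts; rewrite /shorten_run; case: eqP => //; lia. Qed.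

Lemma fill_shorten_run n rho K : fill n (shorten_run rho (size K)) K = fill n rho K.
Proof. by apply: eq_fill_rows => t ts; rewrite /shorten_run; case: eqP => //; lia. Qed.

(** For a run of length [a] in the row of index [r], the existence of a letter on
    which [e] can act: the letters [i] of the next row are matched with this run. *)
Definition spare n (x : qindex n) T r a : Prop :=
  if x is Even i then count_mem i.+1 (nth [::] T r.+1) < a else 0 < a.

(** Besides the boxes of the core, [e_i] can act on the last box of the run of
    [i + 1]; this happens when the core has no unmatched [i + 1], and then depends
    on the length of the run. *)
Lemma tab_e_fill n (x : qindex n) K rho T' : is_core n K -> is_SDT n (fill n rho K) ->
  tab_e x (fill n rho K) = Some T' ->
  (exists K1 k1 k2 K2, [/\ K = K1 ++ (k1 ++ hi x :: k2) :: K2, size K1 + lo x < n &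
    forall rho', is_SDT n (fill n rho' K) ->
      tab_e x (fill n rho' K) = Some (fill n rho' (K1 ++ (k1 ++ lo x :: k2) :: K2))]) \/
  (exists K1 k K2, [/\ K = K1 ++ k :: K2, size K1 + hi x = n,
    x = Odd1 -> k = [::], spare x (fill n rho K) (size K1) (rho (size K1)) &
    forall rho', is_SDT n (fill n rho' K) ->
      spare x (fill n rho' K) (size K1) (rho' (size K1)) ->
      tab_e x (fill n rho' K) =
        Some (fill n (shorten_run rho' (size K1)) (K1 ++ (lo x :: k) :: K2))]).
Proof.
move=> KK S1 /tab_eP [A [B [wE act _]]].
have [T1 [v1 [v2 [T2 [TE AE BE]]]]] := boxP wE.
rewrite {}AE {}BE in act wE; clear wE.
have [K1 [k [K2 [KE sz1 T1E vE T2E]]]] := rows_split (proj1 KK) TE.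
have r1n : size K1 < n by rewrite -(proj1 KK) KE size_cat /=; lia.
have hin : hi x <= n - size K1.
  have /allP/(_ (hi x)) := SDT_letters S1 r1n.
  by rewrite {1}TE nth_cat sz1 ltnn subnn /= mem_cat mem_head orbT => /(_ isT); rewrite /hi; lia.
have rx : size K1 + lo x < n by rewrite /hi in hin; rewrite /lo; lia.
case: (cat_nseq_split vE) => [[k1 v1E kE]|[b [aE hiE v1E v2E]]].
  left; rewrite {}T1E {}T2E {}v1E in act.
  exists K1, k1, v2, K2; rewrite -kE; split => //.
  move=> rho' S2; apply/tab_eP; rewrite KE.
  exists (rd (fill n rho' K1) ++ rev v2),
    (rev (nseq (rho' (size K1)) (n - size K1) ++ k1) ++ rd (fill_rows n rho' (size K1).+1 K2)).
  split.
  - by rewrite fill_rows_cat add0n [fill_rows _ _ _ (_ :: _)]/= kE (catA (nseq _ _)) rd_box.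
  - by move: act; apply: (@active_fill _ _ K1 k1 (hi x) v2 K2 rho); rewrite -?kE -?KE.
  - by rewrite !fill_rows_cat add0n [fill_rows _ _ _ (k :: _)]/=
       [fill_rows _ _ _ (_ :: _)]/= kE !(catA (nseq _ _)) changeE.
(* The box belongs to the run, and is its last one, since an [i + 1] read just
   before would be unmatched. *)
right; have b0 : b = 0.
  case: b v2E {aE} => // b v2E; move: act; rewrite v2E /= -hiE.
  case: (x) => [i|] /=; last by rewrite has_cat has_rev /= orbT.
  by move=> [+ _]; rewrite rev_cons -cats1 catA => /bracket_suffix_count; rewrite /= eqxx eSq_F.
rewrite {}b0 /= addn1 in aE v2E; rewrite {}v2E in act TE vE.
have filt rh : filter (pair_letter (lo x)) (rd (fill n rh K1) ++ rev k) =
    filter (pair_letter (lo x)) (rd K1 ++ rev k).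
  by rewrite !filter_cat filter_rd_fill_rows //; rewrite -[prime_index x]/(lo x); lia.
exists K1, k, K2; split => //.
- by lia.
- move=> xE; rewrite {x}xE in rx hin TE vE hiE act filt *.
  move: act; rewrite /= has_cat negb_or has_rev => /andP[_ nk].
  have [_ /(_ _ r1n) [lk _ _]] := KK; move: lk nk; rewrite KE nth_cat ltnn subnn /=.
  rewrite -hiE /hi /=; case: (k) => //= c w /andP[c2 _].
  by rewrite /pair_letter; lia.
- case: x rx hin TE vE hiE act filt => [i|] rx hin TE vE hiE act filt /=; last by rewrite aE.
  case: act => _; rewrite v1E rev_nseq -hiE T2E => b1.
  have rE : (size K1).+1 + i.+1 = n by move: (hiE) rx; rewrite /hi /lo /=; lia.
  have [nS <-] := count_rd_drop S1 (ltn0Sn i) rE.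
  move: nS b1; rewrite drop_fill_rows add0n KE -cat_rcons drop_size_cat ?size_rcons // => nS.
  rewrite bracket_cat bracket_nseqS (bracket_notinS nS) /bracket_mul /= add0n aE ltnS => /eqP.
  by rewrite subn_eq0.
move=> rho' S2 sp.
have r0 : 0 < rho' (size K1) by case: (x) sp => [i|] //=; apply: leq_ltn_trans.
have K2E : K2 = drop (size K1).+1 K by rewrite KE -cat_rcons drop_size_cat // size_rcons.
have rowE : nseq (rho' (size K1)) (n - size K1) ++ k =
    nseq (rho' (size K1)).-1 (n - size K1) ++ hi x :: k.
  by rewrite -cat_rcons hiE -nseq_rcons prednK.
apply/tab_eP; exists (rd (fill n rho' K1) ++ rev k),
  (rev (nseq (rho' (size K1)).-1 (n - size K1)) ++ rd (fill_rows n rho' (size K1).+1 K2)).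
split.
- by rewrite {1}KE fill_rows_cat add0n [fill_rows _ _ _ (_ :: _)]/= rowE rd_box.
- move: act; rewrite T1E; case: x rx hin {TE vE rowE} hiE filt sp => [i|] rx hin hiE filt sp /=.
    case=> a1 _; split; first by move: a1; rewrite -!(bracket_filter _ (_ ++ _)) !filt.
    have rE : (size K1).+1 + i.+1 = n by move: (hiE) rx; rewrite /hi /lo /=; lia.
    have := @bracket_run_rd _ _ _ _ (rho' (size K1)).-1 S2 (ltn0Sn i) rE.
    rewrite drop_fill_rows add0n -K2E rev_nseq -hiE; apply.
    by move: sp => /=; lia.
  by rewrite !has_filter !filt.
- rewrite {1}KE !fill_rows_cat !add0n fill_shorten_run [fill_rows _ _ _ (_ :: _)]/=.
  rewrite [fill_rows _ rho' _ (_ :: _)]/= fill_rows_shorten_run // /shorten_run eqxx rowE changeE //.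
Qed.

(** * The operators on dual marginally large tableaux *)

Lemma marginal_run_shape K K' r : shape K = shape K' -> marginal_run K r = marginal_run K' r.
Proof.
have rhoE L : marginal_run L r = (sumn (drop r.+1 (map S (shape L)))).+1.
  by rewrite /marginal_run map_drop /shape -map_comp.
by rewrite !rhoE => ->.
Qed.

(** One more box in a row makes all the runs above it longer by one. *)
Lemma marginal_run_cons K1 c k K2 r :
  marginal_run (K1 ++ (c :: k) :: K2) r = marginal_run (K1 ++ k :: K2) r + (r < size K1).
Proof.
rewrite /marginal_run !drop_cat; case: ltngtP => h.
- by rewrite !map_cat !sumn_cat /=; lia.
- have [m ->] : exists m, r.+1 - size K1 = m.+1 by exists (r - size K1); lia.
  by rewrite addn0.
- by rewrite -h subnn /=; lia.
Qed.

Lemma marginal_fill n rho K : is_core n K -> marginal n (fill n rho K) = fill n (marginal_run K) K.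
Proof. by move=> KK; rewrite /marginal core_fill. Qed.

Lemma head_update n K1 k k' K2 : is_core n (K1 ++ k :: K2) ->
  k' = [::] \/ head 0 k' <> n - size K1 ->
  forall r, r < n -> nth [::] (K1 ++ k' :: K2) r = [::] \/
    head 0 (nth [::] (K1 ++ k' :: K2) r) <> n - r.
Proof.
move=> [_ H] hk' r rn; have [_ _] := H r rn; rewrite !nth_cat.
case: ltngtP => // [h|->]; last by rewrite subnn.
by have [m ->] : exists m, r - size K1 = m.+1 by exists (r - size K1).-1; lia.
Qed.

Lemma is_core_update n rho K1 k k' K2 : is_core n (K1 ++ k :: K2) ->
  is_SDT n (fill n rho (K1 ++ k' :: K2)) ->
  k' = [::] \/ head 0 k' <> n - size K1 -> is_core n (K1 ++ k' :: K2).
Proof. by move=> KK S hk'; apply: is_core_of_SDT S _; apply: head_update KK hk'. Qed.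

Lemma fill_rows_update n rho rho' K1 v v' K2 :
  (forall t, t != size K1 -> rho t = rho' t) ->
  nseq (rho (size K1)) (n - size K1) ++ v = nseq (rho' (size K1)) (n - size K1) ++ v' ->
  fill n rho (K1 ++ v :: K2) = fill n rho' (K1 ++ v' :: K2).
Proof.
move=> H E; rewrite !fill_rows_cat !add0n /= E.
by congr (_ ++ _ :: _); apply: eq_fill_rows => t tI; apply: H; lia.
Qed.

Lemma remove_boxes_fill n i rho rho' K : size K = n ->
  (forall r, r < n -> rho r = rho' r + (r < n - i)) ->
  remove_boxes n i (fill n rho K) = fill n rho' K.
Proof.
move=> szK H; apply: (@eq_from_nth _ [::]); first by rewrite size_mkseq size_fill_rows szK.
move=> r; rewrite size_mkseq => rn; rewrite nth_mkseq // !nth_fill_rows ?szK // !add0n H //.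
by case: (r < n - i); rewrite ?addn0 ?addn1.
Qed.

Lemma add_boxes_fill n i rho rho' K : size K = n ->
  (forall r, r < n -> rho' r = rho r + (r < n - i)) ->
  add_boxes n i (fill n rho K) = fill n rho' K.
Proof.
move=> szK H; apply: (@eq_from_nth _ [::]); first by rewrite size_mkseq size_fill_rows szK.
move=> r; rewrite size_mkseq => rn; rewrite nth_mkseq // !nth_fill_rows ?szK // !add0n H //.
by case: (r < n - i); rewrite ?addn0 ?addn1.
Qed.

(** If the changed box joins the run in the row of index [n - i - 1], then the core
    loses this box, and the run of this row and those above become too long by
    one: these are the boxes that the definition removes. *)
Lemma inf_f_marginal n (x : qindex n) T : 1 < n -> is_SDT n T ->
  inf_f x (marginal n T) = omap (marginal n) (tab_f x T).
Proof.
move=> n1 S0; have KK := core_is_core S0; have TE := fill_core (SDT_size S0).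
have Sinf : is_SDT n (fill n (marginal_run (core n T)) (core n T)) by apply/SDTinf_SDT/marginal_SDTinf.
rewrite /inf_f /marginal; move: TE KK Sinf; set K := core n T; set rho := run_length n T => TE KK Sinf.
case E: (tab_f x T) => [T'|] /=; last first.
  case E' : (tab_f x (fill n (marginal_run K) K)) => [U|] //.
  have [K1 [k1 [k2 [K2 [_ _ _ H]]]]] := tab_f_fill n1 KK Sinf E'.
  by have := H rho; rewrite TE E => /(_ S0).
have E0 := E; rewrite -TE in E0; have S0' := S0; rewrite -TE in S0'.
have [K1 [k1 [k2 [K2 [KE rx hk2 H]]]]] := tab_f_fill n1 KK S0' E0.
have [S' _] := tab_f_SDT n1 S0 E.
have T'E : T' = fill n rho (K1 ++ (k1 ++ hi x :: k2) :: K2).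
  by have := H rho S0'; rewrite TE E => -[].
rewrite (H _ Sinf) /=; congr Some.
have [Khead|] := pselect (k1 ++ hi x :: k2 = [::] \/ head 0 (k1 ++ hi x :: k2) <> n - size K1).
  have KK' : is_core n (K1 ++ (k1 ++ hi x :: k2) :: K2).
    by have KK0 := KK; rewrite KE in KK0; apply: (is_core_update (rho := rho) KK0 _ Khead); rewrite -T'E.
  rewrite T'E core_fill //.
  have -> : fill n (marginal_run K) (K1 ++ (k1 ++ hi x :: k2) :: K2) =
      fill n (marginal_run (K1 ++ (k1 ++ hi x :: k2) :: K2)) (K1 ++ (k1 ++ hi x :: k2) :: K2).
    by apply: eq_fill_rows => t _; apply: marginal_run_shape; rewrite KE /shape !map_cat /= !size_cat.
  by rewrite fill_marginal_SDTinf.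
(* The box was the first one after the run, which it extends. *)
move=> Khead; have [k1E hiE] : k1 = [::] /\ hi x = n - size K1.
  have lt : size K1 < n by rewrite -(proj1 KK) KE size_cat /=; lia.
  have [_ _] := proj2 KK _ lt; rewrite KE nth_cat ltnn subnn /=.
  case: (k1) Khead => [|c k1'] /= Khead hd.
    by split => //; apply: contrapT => ne; apply: Khead; right.
  by case: Khead; right; case: hd.
rewrite {}k1E {Khead} /= in T'E KE H *.
set r := size K1 in hiE.
pose inc rh t := rh t + (t == r).
have incE rh : fill n rh (K1 ++ (hi x :: k2) :: K2) = fill n (inc rh) (K1 ++ k2 :: K2).
  apply: fill_rows_update => [t tr|]; rewrite /inc.
    by rewrite (negbTE tr) addn0.
  by rewrite eqxx addn1 nseq_rcons cat_rcons hiE.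
rewrite incE in T'E; rewrite incE.
have KK2 : is_core n (K1 ++ k2 :: K2).
  rewrite KE in KK; apply: (is_core_update (rho := inc rho) KK); first by rewrite -T'E.
  by case: (k2) hk2 => [|c w] /= hk2; [left|right => cE; apply: hk2; rewrite cE hiE].
have szK2 := proj1 KK2.
have rn : r < n by rewrite -szK2 size_cat /=; lia.
have rhoE t : marginal_run K t = marginal_run (K1 ++ k2 :: K2) t + (t < r).
  by rewrite KE marginal_run_cons.
rewrite T'E core_fill //; case: ifP => [dml|_].
  by have := SDTinf_run KK2 dml rn; rewrite /inc eqxx rhoE; lia.
apply: remove_boxes_fill => // t tn; rewrite /inc rhoE -addnA; congr (_ + _).
by move: hiE; rewrite /hi /r; lia.
Qed.

(** A box of the core lowered to [i] stays in the core, so that the runs of a dual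
    marginally large filling keep the right lengths. *)
Lemma marginal_e_box n (x : qindex n) T U K1 k1 k2 K2 : 1 < n -> is_SDT n T ->
  core n T = K1 ++ (k1 ++ hi x :: k2) :: K2 -> size K1 + lo x < n ->
  tab_e x T = Some (fill n (run_length n T) (K1 ++ (k1 ++ lo x :: k2) :: K2)) ->
  U = fill n (marginal_run (core n T)) (K1 ++ (k1 ++ lo x :: k2) :: K2) ->
  is_SDTinf n U /\ U = marginal n (fill n (run_length n T) (K1 ++ (k1 ++ lo x :: k2) :: K2)).
Proof.
move=> n1 S0 KE rx E UE; have KK := core_is_core S0.
have [S' _] := tab_e_SDT n1 S0 E.
have KK' : is_core n (K1 ++ (k1 ++ lo x :: k2) :: K2).
  rewrite KE in KK; apply: (is_core_update KK S'); right.
  have lt : size K1 < n by lia.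
  case: (k1) KK => [|c k1'] KK /=; first by lia.
  by have [_ _] := proj2 KK _ lt; rewrite nth_cat ltnn subnn /=; case.
have -> : U = fill n (marginal_run (K1 ++ (k1 ++ lo x :: k2) :: K2)) (K1 ++ (k1 ++ lo x :: k2) :: K2).
  by rewrite UE; apply: eq_fill_rows => t _; apply: marginal_run_shape;
     rewrite KE /shape !map_cat /= !size_cat.
by rewrite marginal_fill //; split => //; apply: fill_marginal_SDTinf.
Qed.

(** If [e] acts on a run, then the core gains a box, this run and those above
    become too short by one, and the definition adds the missing boxes.  In a
    dual marginally large tableau a run always has a letter to spare, which is
    why the converse fails without the tensor factor. *)
Lemma inf_e_marginal n (x : qindex n) T T' : 1 < n -> is_SDT n T ->
  tab_e x T = Some T' -> inf_e x (marginal n T) = Some (marginal n T').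
Proof.
move=> n1 S0 E; have KK := core_is_core S0; have TE := fill_core (SDT_size S0).
have Sinf : is_SDT n (fill n (marginal_run (core n T)) (core n T)) by apply/SDTinf_SDT/marginal_SDTinf.
have E0 := E; rewrite -TE in E0; have S0' := S0; rewrite -TE in S0'.
have [S' _] := tab_e_SDT n1 S0 E.
rewrite /inf_e {1}/marginal.
have [[K1 [k1 [k2 [K2 [KE rx H]]]]]|[K1 [k [K2 [KE rx _ sp H]]]]] := tab_e_fill KK S0' E0.
  have := H _ S0'; rewrite TE E => -[T'E].
  rewrite (H _ Sinf) /=; rewrite T'E in E *.
  by have [-> <-] := marginal_e_box n1 S0 KE rx E erefl.
have := H _ S0' sp; rewrite TE E => -[T'E].
set K := core n T in KK TE Sinf KE H T'E *.
set r := size K1 in rx sp H T'E.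
have rn : r < n by move: rx; rewrite /hi; lia.
have rho0 : 0 < marginal_run K r by [].
rewrite (H _ Sinf); last first.
  have := marginal_run_row (proj1 KK) rn.
  by case: (x) => [i|] /=; [move=> ->; rewrite ltnS; apply: count_size|].
rewrite /=; congr Some.
have hdk : lo x :: k = [::] \/ head 0 (lo x :: k) <> n - size K1.
  by right => /=; move: rx; rewrite /hi /lo /r; lia.
have KK2 : is_core n (K1 ++ (lo x :: k) :: K2).
  by rewrite KE in KK; apply: (is_core_update (rho := shorten_run (run_length n T) r) KK _ hdk); rewrite -T'E.
have szK2 := proj1 KK2.
have rhoE t : marginal_run (K1 ++ (lo x :: k) :: K2) t = marginal_run K t + (t < r).
  by rewrite KE marginal_run_cons.
rewrite T'E marginal_fill //; case: ifP => [dml|_].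
  by have := SDTinf_run KK2 dml rn; rewrite /shorten_run eqxx rhoE; lia.
apply: add_boxes_fill => // t tn; rewrite /shorten_run rhoE.
case: eqP => [->|tr]; first by rewrite -/(lo x); move: rx; rewrite /hi /lo; lia.
by congr (_ + _); move: rx; rewrite /hi /lo; lia.
Qed.

(** The tensor factor does not interfere with the odd operators.  They act on a run
    only if the core has no letter [1] or [2]; the row of index [n - 2] is then
    reduced to its run, which has a letter as soon as the row has. *)
Lemma inf_e_odd_marginal n T : 1 < n -> is_SDT n T -> nth [::] T n.-2 <> [::] ->
  tab_e (Odd1 : qindex n) T = None -> inf_e (Odd1 : qindex n) (marginal n T) = None.
Proof.
move=> n1 S0 nz E; have KK := core_is_core S0; have TE := fill_core (SDT_size S0).
have Sinf : is_SDT n (fill n (marginal_run (core n T)) (core n T)) by apply/SDTinf_SDT/marginal_SDTinf.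
rewrite /inf_e /marginal; case E' : tab_e => [U|] //.
have S0' := S0; rewrite -TE in S0'.
have [[K1 [k1 [k2 [K2 [_ _ H]]]]]|[K1 [k [K2 [KE rx kE _ H]]]]] := tab_e_fill KK Sinf E'.
  by have := H _ S0'; rewrite TE E.
suff sp : 0 < run_length n T (size K1) by have := H _ S0' sp; rewrite TE E.
have rE : size K1 = n.-2 by move: rx; rewrite /hi /=; lia.
have kE0 : nth [::] (core n T) (size K1) = [::] by rewrite KE nth_cat ltnn subnn /= kE.
rewrite lt0n; apply/eqP => run0; apply: nz.
move: kE0; rewrite nth_mkseq ?rE; last lia.
by rewrite rE in run0; rewrite run0 drop0.
Qed.

(** * Components and connectedness *)

(** A strict embedding of a connected crystal is an isomorphism onto a component. *)
Lemma component_isomorphic n (B C : crystal n) (phi : C -> B) (c0 : C) :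
  injective phi ->
  (forall i c, cwti i (phi c) = cwti i c) ->
  (forall i c, ceps i (phi c) = ceps i c) ->
  (forall i c, cphi i (phi c) = cphi i c) ->
  (forall x c, ce x (phi c) = omap phi (ce x c)) ->
  (forall x c, cf x (phi c) = omap phi (cf x c)) ->
  (forall c, connected c0 c) ->
  isomorphic (component (phi c0)) C.
Proof.
move=> inj Hwt Heps Hphi He Hf conn.
have surj (y : component (phi c0)) : exists c, phi c = val y.
  case: y => y /= /asboolP; elim=> [|i x z _ [c cE]|i x z _ [c cE]].
  - by exists c0.
  - by rewrite -cE He; case: (ce i c) => //= c' [<-]; exists c'.
  - by rewrite -cE Hf; case: (cf i c) => //= c' [<-]; exists c'.
have img c : connected (phi c0) (phi c).
  elim: (conn c) => [|i x y _ IH xy|i x y _ IH xy]; first exact: conn_refl.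
    by apply: (conn_e (i := i) IH); rewrite He xy.
  by apply: (conn_f (i := i) IH); rewrite Hf xy.
pose g y := sval (cid (surj y)).
have gE y : phi (g y) = val y by rewrite /g; case: cid.
pose h c : component (phi c0) := exist _ (phi c) (asboolT (img c)).
have hK c : g (h c) = c by apply: inj; rewrite gE.
have gK y : h (g y) = y by apply: val_inj; rewrite /= gE.
have insubE c : insub (phi c) = Some (h c).
  by rewrite insubT; [exact: asboolT|move=> p; congr Some; apply: val_inj].
exists (fun y => Some (g y)); split; last first.
  by exists (omap h) => [[y|]|[c|]] //=; rewrite ?gK ?hK.
split=> [b c [<-]|b c [<-]|b c [<-]|b c [<-] i _ _|b c [<-] i _ _].
- by move=> i; rewrite -Hwt gE.
- by move=> i; rewrite -Heps gE.
- by move=> i; rewrite -Hphi gE.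
- rewrite /= -gE He; case: (ce i (g b)) => //= d.
  by rewrite insubE /= hK.
- rewrite /= -gE Hf; case: (cf i (g b)) => //= d.
  by rewrite insubE /= hK.
Qed.

Section Connected.
Variables (n : nat) (lam : n.-tuple nat).

Definition SDT_of T (PT : is_SDT n T && (shape T == lam)) : SDT lam :=
  exist (fun T => [pred T : tableau | is_SDT n T && (shape T == lam)] T) T PT.

Lemma change_undo T A c a B : rd T = A ++ c :: B ->
  [/\ rd (change T (size A) a) = A ++ a :: B,
      shape (change T (size A) a) = shape T &
      change (change T (size A) a) (size A) c = T].
Proof.
move=> /boxP [T1 [v1 [v2 [T2 [-> -> ->]]]]].
by rewrite !changeE // rd_box /shape !map_cat /= !size_cat.
Qed.

(** Paths of words lift to paths of tableaux, because the latter are stable under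
    the operators. *)
Lemma word_conn_lift u w : 1 < n -> word_conn n u w -> forall T : SDT lam, rd (val T) = u ->
  exists2 T' : SDT lam, rd (val T') = w & connected T' T.
Proof.
move=> n1; elim=> [{}w T <-|{}u v {}w [x [A [B [uE vE act]]]] _ IH T TE|
                   {}u v {}w [x [A [B [vE uE act]]]] _ IH T TE].
- by exists T => //; apply: conn_refl.
- have /andP[T_SDT shT] := valP T.
  have [rd1 sh1 back] := change_undo (lo x) (etrans TE uE).
  have E : tab_e x (val T) = Some (change (val T) (size A) (lo x)).
    by apply/tab_eP; exists A, B; rewrite TE uE.
  have [S1 _] := tab_e_SDT n1 T_SDT E.
  have P1 : is_SDT n (change (val T) (size A) (lo x)) &&
            (shape (change (val T) (size A) (lo x)) == lam) by rewrite S1 sh1.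
  have [|T' wE c] := IH (SDT_of P1); first by rewrite /= rd1 vE.
  exists T' => //; apply: (conn_f (i := x) c).
  have -> : cf x (SDT_of P1) = obind insub (tab_f x (change (val T) (size A) (lo x))) by [].
  have -> : tab_f x (change (val T) (size A) (lo x)) = Some (val T).
    by apply/tab_fP; exists A, B; rewrite rd1 back.
  by rewrite /= valK.
- have /andP[T_SDT shT] := valP T.
  have [rd1 sh1 back] := change_undo (hi x) (etrans TE uE).
  have E : tab_f x (val T) = Some (change (val T) (size A) (hi x)).
    by apply/tab_fP; exists A, B; rewrite TE uE.
  have [S1 _] := tab_f_SDT n1 T_SDT E.
  have P1 : is_SDT n (change (val T) (size A) (hi x)) &&
            (shape (change (val T) (size A) (hi x)) == lam) by rewrite S1 sh1.
  have [|T' wE c] := IH (SDT_of P1); first by rewrite /= rd1 vE.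
  exists T' => //; apply: (conn_e (i := x) c).
  have -> : ce x (SDT_of P1) = obind insub (tab_e x (change (val T) (size A) (hi x))) by [].
  have -> : tab_e x (change (val T) (size A) (hi x)) = Some (val T).
    by apply/tab_eP; exists A, B; rewrite rd1 back.
  by rewrite /= valK.
Qed.

Lemma SDT_connected (L T : SDT lam) : 1 < n -> val L = Ltab n lam -> connected L T.
Proof.
move=> n1 LE; have /andP[T_SDT shT] := valP T.
have lT : letters_in n (rd (val T)).
  apply/allP => z /flattenP [v /mapP [w wT ->]]; rewrite mem_rev.
  by have /is_SDTP [_ /allP/(_ _ wT) /allP H _] := T_SDT; apply: H.
have [w [c st]] := word_conn_strict n1 lT.
have [T' T'E conn] := word_conn_lift n1 c erefl.
suff -> : L = T' by [].
have /andP[T'_SDT /eqP shT'] := valP T'.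
by apply: val_inj; rewrite LE (SDT_strict_prefixes T'_SDT) ?T'E // shT'.
Qed.

End Connected.

Lemma count_fill_rows n rho r K c : count_mem c (rd (fill_rows n rho r K)) =
  count_mem c (rd K) + \sum_(t < size K) (n - (r + t) == c) * rho (r + t).
Proof.
elim: K r => [|k K IH] r /=; first by rewrite big_ord0.
rewrite big_ord_recl !rd_cons !count_cat !count_rev count_cat count_nseq IH /= addn0.
under [in RHS]eq_bigr => t _ do rewrite /bump /= add1n addnS -addSn.
lia.
Qed.

Lemma LtabE n s : Ltab n s = fill n (nth 0 s) (nseq n [::]).
Proof.
apply: (@eq_from_nth _ [::]); first by rewrite size_mkseq size_fill_rows size_nseq.
move=> r; rewrite size_mkseq => rn.
by rewrite nth_mkseq // nth_fill_rows ?size_nseq // nth_nseq rn cats0.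
Qed.

Lemma count_Ltab n s c : count_mem c (rd (Ltab n s)) =
  \sum_(t < n) (n - t == c) * nth 0 s t.
Proof.
rewrite LtabE count_fill_rows size_nseq.
have -> : count_mem c (rd (nseq n [::])) = 0.
  by apply/count_memPn/negP => /flattenP [v /mapP [w /nseqP[-> _] ->]].
by [].
Qed.

(** Runs cancel in the comparison with the tableau of lowest weight of the same
    shape. *)
Lemma inf_wt_fill n rho rho' K : size K = n ->
  inf_wt n (fill n rho K) = inf_wt n (fill n rho' K).
Proof.
move=> szK; apply/matrixP => a j; rewrite !mxE !count_Ltab !count_fill_rows szK.
have E rh : \sum_(t < n) (n - t == j.+1) * nth 0 (shape (fill n rh K)) t =
    \sum_(t < n) (n - t == j.+1) * rh t + \sum_(t < n) (n - t == j.+1) * size (nth [::] K t).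
  rewrite -big_split /=; apply: eq_bigr => t _.
  rewrite (nth_map [::]) ?size_fill_rows ?szK // nth_fill_rows ?szK // size_cat size_nseq.
  by rewrite add0n mulnDr.
rewrite !E; under eq_bigr do rewrite add0n.
under [in RHS]eq_bigr do rewrite add0n.
lia.
Qed.

(** * The embedding into the tensor product *)

Lemma count_Ltab_row n s (j : 'I_n) :
  count_mem j.+1 (rd (Ltab n s)) = nth 0 s (rev_ord j).
Proof.
rewrite count_Ltab (bigD1 (rev_ord j)) //= big1.
  by rewrite addn0 (_ : n - (n - j.+1) == j.+1) ?mul1n //; case: j => /= j; lia.
move=> t tj; rewrite (_ : (n - t == j.+1) = false) //.
apply/eqP => E; move/eqP: tj; apply; apply: val_inj => /=.
by case: t j E => t tn [j jn] /=; lia.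
Qed.

Lemma tab_phi_fill n rho rho' K (i : 'I_n.-1) : is_core n K ->
  is_SDT n (fill n rho K) -> is_SDT n (fill n rho' K) ->
  tab_phi i (fill n rho K) = tab_phi i (fill n rho' K).
Proof.
move=> KK S1 S2; rewrite !tab_phiE.
have i1 : 0 + i.+1 < n by case: (i) => i0 /=; lia.
have := bracket_tail_indep KK S1 S2 (ltn0Sn i) i1; have := proj1 KK.
case: (K) => [|k K'] szK; first by have := leq_trans i1 (eq_leq (esym szK)).
by rewrite /= drop0 !rd_cons !rev_cat !rev_nseq -!catA !bracket_cat /bracket_mul /= => ->.
Qed.

Lemma pairing_tab_wt n T (i : 'I_n.-1) :
  pairing (tab_wt n T) i = ((tab_phi i T)%:Z - (tab_eps i T)%:Z)%R.
Proof.
rewrite /pairing !mxE tab_phiE tab_epsE /cur /nxt /=.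
have := bracket_count i.+1 (rd T).
set a := count_mem i.+1 _; set b := count_mem i.+2 _; lia.
Qed.

Lemma pairingD n (u v : 'rV[int]_n) i : pairing (u + v)%R i = (pairing u i + pairing v i)%R.
Proof. by rewrite /pairing !mxE opprD addrACA. Qed.

Lemma pairingB n (u v : 'rV[int]_n) i : pairing (u - v)%R i = (pairing u i - pairing v i)%R.
Proof. by rewrite /pairing !mxE !opprD addrACA opprK. Qed.

Section Embedding.
Variables (n : nat) (lam : n.-tuple nat).
Hypothesis n1 : 1 < n.
Hypothesis lam_strict : forall i : 'I_n.-1, tnth lam (nxt i) < tnth lam (cur i).
Variable mu : 'rV[int]_n.
Hypothesis muE : forall i, pairing mu i = pairing (tab_wt n (Ltab n lam)) i.

Lemma SDT_valP (T : SDT lam) : is_SDT n (val T) /\ shape (val T) = lam.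
Proof. by have /andP[? /eqP] := valP T. Qed.

Definition marginal_elt (T : SDT lam) : SDTinf n :=
  exist (is_SDTinf n) (marginal n (val T)) (marginal_SDTinf (proj1 (SDT_valP T))).

Definition embed (T : SDT lam) : tensor (SDTinf n) (Rvee mu) := (marginal_elt T, tt).

Lemma embed_inj : injective embed.
Proof.
move=> T1 T2 [E]; apply: val_inj.
have [S1 sh1] := SDT_valP T1; have [S2 sh2] := SDT_valP T2.
have K1 := core_is_core S1; have K2 := core_is_core S2.
have coreE : core n (val T1) = core n (val T2).
  rewrite -(core_fill (marginal_run (core n (val T1))) K1).
  rewrite -[in RHS](core_fill (marginal_run (core n (val T2))) K2).
  by rewrite -![fill _ _ _]/(marginal _ _) E.
rewrite -(fill_core (SDT_size S1)) -(fill_core (SDT_size S2)) coreE.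
apply: eq_fill_rows => t; rewrite add0n (proj1 K2) => /andP[_ tn].
have szE T : is_SDT n T -> size (nth [::] T t) = run_length n T t + size (nth [::] (core n T) t).
  move=> S; rewrite -{1}(fill_core (SDT_size S)) nth_fill_rows ?(proj1 (core_is_core S)) //.
  by rewrite size_cat size_nseq add0n.
have := szE _ S1; have := szE _ S2; rewrite coreE.
have -> : size (nth [::] (val T1) t) = size (nth [::] (val T2) t).
  by rewrite -!(nth_map [::] 0) ?(SDT_size S1) ?(SDT_size S2) // -!/(shape _) sh1 sh2.
by move=> ->; lia.
Qed.

Lemma inf_wt_marginal T : is_SDT n T ->
  inf_wt n (marginal n T) = (tab_wt n T - tab_wt n (Ltab n (shape T)))%R.
Proof.
move=> S; rewrite /marginal (inf_wt_fill _ (run_length n T) (proj1 (core_is_core S))).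
by rewrite fill_core //; apply: SDT_size.
Qed.

Lemma tab_phi_marginal T (i : 'I_n.-1) : is_SDT n T -> tab_phi i (marginal n T) = tab_phi i T.
Proof.
move=> S; rewrite -{2}(fill_core (SDT_size S)); apply: tab_phi_fill.
- exact: core_is_core.
- exact: SDTinf_SDT (marginal_SDTinf S).
- by rewrite fill_core //; apply: SDT_size.
Qed.

Lemma pairing_inf_wt (T : SDT lam) i :
  pairing (inf_wt n (marginal n (val T))) i = (pairing (tab_wt n (val T)) i - pairing mu i)%R.
Proof. by have [S sh] := SDT_valP T; rewrite inf_wt_marginal // pairingB sh muE. Qed.

Lemma embed_wti i (T : SDT lam) : cwti i (embed T) = cwti i T.
Proof. by rewrite /cwti /= pairingD pairing_inf_wt subrK. Qed.

(** Here [mu] plays its role: [eps_i] of a dual marginally large tableau is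
    computed from the core, without the runs; [mu] restores those of shape
    [lam]. *)
Lemma embed_eps i (T : SDT lam) : ceps i (embed T) = ceps i T.
Proof.
have [S _] := SDT_valP T.
rewrite /= pairing_inf_wt tab_phi_marginal // pairing_tab_wt /zadd /zmax /zle /cwti /=.
set e := tab_eps i _; set p := tab_phi i _; set m := pairing mu i.
have -> : (p%:Z - (p%:Z - e%:Z - m) - m = e%:Z)%R by lia.
by [].
Qed.

Lemma embed_phi i (T : SDT lam) : cphi i (embed T) = cphi i T.
Proof.
have [S _] := SDT_valP T.
rewrite /= /cwti /= pairing_inf_wt tab_phi_marginal // pairing_tab_wt /zmax /zle.
set e := tab_eps i _; set p := tab_phi i _; set m := pairing mu i.
by case: ifP => // h; congr Fin; lia.
Qed.

Lemma insub_marginal (o o' : option tableau) (S : forall T, o = Some T -> is_SDT n T && (shape T == lam)) :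
  o' = omap (marginal n) o ->
  obind insub o' = omap marginal_elt (obind insub o : option (SDT lam)).
Proof.
case: o S => [T|] S -> //=.
have PT := S T erefl.
rewrite (insubT (is_SDTinf n) (marginal_SDTinf (proj1 (andP PT)))).
rewrite (insubT [pred T : tableau | is_SDT n T && (shape T == lam)] PT) /=.
by congr Some; apply: val_inj.
Qed.

(** For [i] in [I_0], the condition in the tensor product rule amounts to
    [eps_i T] being positive.  For the odd index, the hypothesis on [lam] ensures
    that the row of index [n - 2] is not empty. *)
Lemma embed_e x (T : SDT lam) : ce x (embed T) = omap embed (ce x T).
Proof.
have [S sh] := SDT_valP T.
have closed T' : tab_e x (val T) = Some T' -> is_SDT n T' && (shape T' == lam).
  by move=> E; have [-> ->] := tab_e_SDT n1 S E; rewrite sh eqxx.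
have left_act : inf_e x (marginal n (val T)) = omap (marginal n) (tab_e x (val T)) ->
    omap (fun b => (b, tt)) (ce x (marginal_elt T)) = omap embed (ce x T).
  move=> H; rewrite /= (insub_marginal closed H).
  by case: (obind _ _).
have H T' : tab_e x (val T) = Some T' ->
    inf_e x (marginal n (val T)) = omap (marginal n) (tab_e x (val T)).
  by move=> E; rewrite (inf_e_marginal n1 S E) E.
case: x closed left_act H => [i|] closed left_act H.
  have -> : ce (Even i) (embed T) =
    if zlt (Fin (pairing mu i)) (ceps i (marginal_elt T)) then
      omap (fun b => (b, tt)) (ce (Even i) (marginal_elt T)) else None by [].
  rewrite [ceps _ _]/= pairing_inf_wt tab_phi_marginal // pairing_tab_wt /zlt /zle.
  set e := tab_eps i _; set p := tab_phi i _; set m := pairing mu i.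
  have -> : (p%:Z - (p%:Z - e%:Z - m) <= m)%R = (e == 0) by lia.
  case: eqP => [e0|/eqP e0]; rewrite [LHS]/=.
    have -> : ce (Even i) T = obind insub (tab_e (Even i) (val T)) by [].
    suff -> : tab_e (Even i) (val T) = None by [].
    rewrite /=; case E : [seq _ <- _ | _] => [|y s] //.
    by move: e0; rewrite /e /tab_eps -size_filter E.
  apply: left_act; case E : (tab_e (Even i) (val T)) => [T'|]; first by rewrite (H _ E) E.
  move: E e0; rewrite /e /tab_eps -size_filter /=.
  by case: [seq _ <- _ | _].
have {left_act} <- : omap (fun b => (b, tt)) (ce Odd1 (marginal_elt T)) = omap embed (ce Odd1 T).
  apply: left_act; case E : (tab_e (Odd1 : qindex n) (val T)) => [T'|].
    by rewrite (H _ E) E.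
  apply: inf_e_odd_marginal => // nz.
  have lt : n.-2 < n.-1 by lia.
  have := lam_strict (Ordinal lt); rewrite !(tnth_nth 0) /= -sh.
  by rewrite [X in _ < X](nth_map [::]) ?(SDT_size S) ?nz //; lia.
have -> : ce Odd1 (embed T) = if (ce Odd1 (marginal_elt T), cf Odd1 (marginal_elt T)) is (None, None)
    then None else omap (fun b => (b, tt)) (ce Odd1 (marginal_elt T)) by [].
by case: (cf Odd1 (marginal_elt T)); case: (ce Odd1 (marginal_elt T)).
Qed.

Lemma embed_f x (T : SDT lam) : cf x (embed T) = omap embed (cf x T).
Proof.
have [S sh] := SDT_valP T.
have closed T' : tab_f x (val T) = Some T' -> is_SDT n T' && (shape T' == lam).
  by move=> E; have [-> ->] := tab_f_SDT n1 S E; rewrite sh eqxx.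
have left_act : omap (fun b => (b, tt)) (cf x (marginal_elt T)) = omap embed (cf x T).
  rewrite /= (insub_marginal closed (inf_f_marginal x n1 S)).
  by case: (obind _ _).
case: x closed left_act => [i|] closed left_act.
  have -> : cf (Even i) (embed T) =
    if zle (Fin (pairing mu i)) (ceps i (marginal_elt T)) then
      omap (fun b => (b, tt)) (cf (Even i) (marginal_elt T)) else None by [].
  rewrite left_act [ceps _ _]/= pairing_inf_wt tab_phi_marginal // pairing_tab_wt /zle.
  set e := tab_eps i _; set p := tab_phi i _; set m := pairing mu i.
  by have -> : (m <= p%:Z - (p%:Z - e%:Z - m))%R by lia.
have -> : cf Odd1 (embed T) = if (ce Odd1 (marginal_elt T), cf Odd1 (marginal_elt T)) is (None, None)
    then None else omap (fun b => (b, tt)) (cf Odd1 (marginal_elt T)) by [].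
by rewrite -left_act; case: (cf Odd1 (marginal_elt T)); case: (ce Odd1 (marginal_elt T)).
Qed.

End Embedding.

Lemma marginal_Ltab n (lam : n.-tuple nat) : is_SDT n (Ltab n lam) ->
  marginal n (Ltab n lam) = Linf_tab n.
Proof.
move=> S; have KE : is_core n (nseq n [::]).
  by rewrite LtabE in S; apply: (is_core_of_SDT S) => r rn; left; rewrite nth_nseq rn.
rewrite LtabE (marginal_fill _ KE) /Linf_tab LtabE; apply: eq_fill_rows => t.
rewrite size_nseq add0n => /andP[_ tn]; rewrite nth_mkseq // /marginal_run.
rewrite drop_nseq map_nseq sumn_nseq /=; lia.
Qed.

Lemma Ltab_SDT n (lam : n.-tuple nat) : LambdaMinus n lam ->
  (forall i : 'I_n.-1, tnth lam (nxt i) < tnth lam (cur i)) ->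
  is_SDT n (Ltab n lam) && (shape (Ltab n lam) == lam).
Proof.
move=> lamI lam_strict.
have rowE r : nth [::] (Ltab n lam) r = nseq (nth 0 lam r) (n - r).
  have [rn|rn] := ltnP r n; first by rewrite nth_mkseq.
  by rewrite !nth_default ?size_mkseq ?size_tuple.
have shE : shape (Ltab n lam) = lam.
  apply: (@eq_from_nth _ 0); first by rewrite size_map size_mkseq size_tuple.
  move=> r; rewrite size_map size_mkseq => rn.
  by rewrite (nth_map [::]) ?size_mkseq // rowE size_nseq.
rewrite shE eqxx andbT; apply/is_SDTP; rewrite shE; split => //.
  apply/allP => v /(nthP [::]) [r]; rewrite size_mkseq => rn <-.
  by rewrite rowE; apply/allP => c /nseqP[-> _]; lia.
move=> r rn; rewrite !rowE; have [->|lr] := posnP (nth 0 lam r); first by apply/row_okP; left.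
rewrite -[nseq (nth 0 lam r) _]cats0; apply: long_run_row_ok => //.
- by apply/allP => c /nseqP[-> _] /=; lia.
- by exists [::], [::].
rewrite size_nseq; have [lt|le] := ltnP r.+1 n; last by rewrite nth_default ?size_tuple.
have lt' : r < n.-1 by lia.
by have := lam_strict (Ordinal lt'); rewrite !(tnth_nth 0).
Qed.

Unset Implicit Arguments.

Theorem theorem3p21 (n : nat) (hn : (2 <= n)%N)
    (lam : n.-tuple nat) (hlam : LambdaMinus n lam)
    (hstrict : forall i : 'I_n.-1, (tnth lam (nxt i) < tnth lam (cur i))%N)
    (k : int) (hk : (- (min_I0 lam)%:Z <= k)%R)
    (mu : 'rV[int]_n)
    (hmu : mu = (\sum_(i < n) ((tnth lam i)%:Z - k) *: delta_mx ord0 (rev_ord i))%R) :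
  isomorphic
    (component (B := tensor (SDTinf n) (Rvee mu)) (Linf n, tt))
    (SDT lam).
Proof.
have PL := Ltab_SDT hlam hstrict.
(* The multiple [k] of [(1, ..., 1)] vanishes in the pairings. *)
have muE i : pairing mu i = pairing (tab_wt n (Ltab n lam)) i.
  have muj j : mu ord0 j = ((tab_wt n (Ltab n lam)) ord0 j - k)%R.
    rewrite hmu summxE !mxE count_Ltab_row (bigD1 (rev_ord j)) //= big1.
      by rewrite !mxE rev_ordK !eqxx /= mulr1 addr0 (tnth_nth 0).
    move=> t tj; rewrite !mxE /= (_ : (j == rev_ord t) = false) ?mulr0 //.
    by apply/eqP => E; move/eqP: tj; apply; rewrite E rev_ordK.
  by rewrite /pairing !muj opprB addrA subrK.
pose L : SDT lam := SDT_of PL.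
have -> : (Linf n, tt) = embed mu L.
  by congr pair; apply: val_inj; rewrite /= marginal_Ltab //; case/andP: (PL).
apply: component_isomorphic.
- exact: embed_inj.
- exact: embed_wti.
- exact: embed_eps.
- exact: embed_phi.
- exact: embed_e.
- exact: embed_f.
- by move=> T; apply: SDT_connected.
Qed.
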